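(* There exists a randomized distributed algorithm that solves $\mathrm{DenseSubgraph}(\tilde{D}, \epsilon)$ with high probability (i.e., with probability at least $1-1/n^c$ for an arbitrarily large constant $c$) and runs in $O((\log^3 n)/\epsilon^3)$ rounds in the CONGEST model.
   Context: Let $G=(V,E)$ be a simple undirected graph with $n$ vertices, which is both the input graph and the communication network. For a subgraph $H$, its density is $d(H)=|E(H)|/|V(H)|$, and $D=\max_{H\subseteq G} d(H)$. In the CONGEST model, vertices have unique IDs and operate in synchronous rounds; in each round every vertex sends a message of $O(\log n)$ bits to each neighbor, receives messages from its neighbors, and performs local computation; complexity is the number of rounds. Problem $\mathrm{DenseSubgraph}(\tilde{D}, \epsilon)$: given $G$, a parameter $\tilde D\ge 0$ and $0<\epsilon<1$, every vertex $u$ outputs $h_u\in\{0,1\}$ such that the subgraph $H$ induced by $\{u : h_u=1\}$ satisfies $d(H)\ge(1-\epsilon)\tilde D$; moreover, if $\tilde D\le D$ then $H$ must be non-empty. *)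

(* Defs.v *)
From mathcomp Require Import all_boot all_order all_algebra.
From mathcomp Require Import reals exp.

Set Implicit Arguments.
Unset Strict Implicit.
Unset Printing Implicit Defensive.

Import Order.TTheory GRing.Theory Num.Theory.
Local Open Scope ring_scope.

Record sgraph := SGraph {
  vertex :> finType;
  edge : rel vertex;
  edge_sym : symmetric edge;
  edge_irrefl : irreflexive edge }.

Section Density.
Variables (R : realType) (G : sgraph).

Definition edges : {set {set G}} :=
  [set [set p.1; p.2] | p : G * G & edge p.1 p.2].

(* A pair (vertex set, edge set); it need not be induced. *)
Definition is_subgraph (H : {set G} * {set {set G}}) : bool :=
  (H.2 \subset edges) && [forall f in H.2, f \subset H.1].

Definition density (H : {set G} * {set {set G}}) : R :=
  #|H.2|%:R / #|H.1|%:R.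

(* Densities are nonnegative, so the default value 0 does not affect the
   maximum as soon as G has a vertex. *)
Definition max_density : R :=
  \big[Num.max/0]_(H : {set G} * {set {set G}} |
                    is_subgraph H && (H.1 != set0)) density H.

Definition induced (U : {set G}) : {set G} * {set {set G}} :=
  (U, [set f in edges | f \subset U]).

(* The density of the empty graph is undefined: an empty output is legal
   exactly when [Dt] exceeds the maximum density. *)
Definition dense_subgraph (Dt eps : R) (h : G -> bool) : bool :=
  let H := induced [set u | h u] in
  ((H.1 != set0) ==> ((1 - eps) * Dt <= density H)) &&
  ((Dt <= max_density) ==> (H.1 != set0)).

End Density.

(* The program run by every vertex of a network.  Global parameters known to
   all vertices (number of vertices, problem parameters) are arguments of a
   family of programs.  Local computation is unrestricted.  Messages are bit
   strings of length at most [bandwidth]; neighbours are addressed by ID. *)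
Record congest_program := CongestProgram {
  rounds : nat;
  bandwidth : nat;
  random_bits : nat;
  state : Type;
  (* own ID, increasing list of the neighbours' IDs, private random bits *)
  init : nat -> seq nat -> random_bits.-tuple bool -> state;
  (* message to the neighbour with the given ID *)
  send : state -> nat -> bandwidth.-bseq bool;
  (* new state from the messages received, indexed by the sender's ID *)
  receive : state -> (nat -> option (bandwidth.-bseq bool)) -> state;
  output : state -> bool }.

Arguments init : clear implicits.

Section Execution.
Variables (G : sgraph) (id : G -> nat) (P : congest_program).

Definition neighbour_ids (v : G) : seq nat :=
  sort leq [seq id u | u <- enum (edge v)].

Definition inbox (s : G -> state P) (v : G) (i : nat)
    : option ((bandwidth P).-bseq bool) :=
  if [pick u | edge v u && (id u == i)] is Some u
  then Some (send (s u) (id v)) else None.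

Definition coins : finType := {ffun G -> (random_bits P).-tuple bool}.

Fixpoint config (w : coins) (t : nat) : G -> state P :=
  if t is t'.+1
  then fun v => receive (config w t' v) (inbox (config w t') v)
  else fun v => init P (id v) (neighbour_ids v) (w v).

Definition result (w : coins) (v : G) : bool :=
  output (config w (rounds P) v).

(* All bits of all vertices are independent and uniform, i.e. [coins] carries
   the uniform distribution. *)
Definition prob (R : realType) (E : pred coins) : R :=
  #|[set w | E w]|%:R / #|coins|%:R.

End Execution.

(* Distinct IDs of O(log n) bits. *)
Definition id_assignment (k : nat) (G : sgraph) (id : G -> nat) : Prop :=
  injective id /\ forall v, (id v < #|G| ^ k)%N.

(* Main.v *)
(* The algorithm makes O(log n) independent trials; vertices found in a trial are
   marked and leave the graph, so that the final output is a disjoint union of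
   sets of density at least the capacity K = (1 - eps) Dt.

   In a trial, random geometric shifts of rate about eps partition the graph into
   clusters of radius O(log n / eps) (Miller-Peng-Xu), cutting each edge with
   probability O(eps).  By Markov's inequality at most an eps / 4 fraction of the
   edges of a densest subgraph is cut with probability at least 1 / 2.

   Multiplicative weights are then run with the edges as experts: in each of
   O(log n / eps^2) rounds every vertex distributes K units, at most one per edge,
   to its least loaded uncut edges.  The width of this game is 2, whatever the
   degrees.  If, for a round t and a load threshold theta, the set of vertices
   having more than K edges of load at most theta is not dense, then those edges
   receive in round t at least one unit on average.  If this holds for all t and
   for O(log n / eps) thresholds per round, every edge ends up with average load
   at least 1 - O(eps), and as the vertices of a subgraph give at most K per round,
   no uncut subgraph has density above (1 + O(eps)) K.  Hence a cluster containing
   a dense enough subgraph has a dense threshold set.  The degree sums of the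
   O(log^2 n / eps^3) threshold sets are aggregated along the cluster trees in a
   pipeline, and the root broadcasts the index of a dense one. *)

Require Import Defs.
From mathcomp Require Import all_boot all_order all_algebra.
From mathcomp Require Import reals sequences exp.
From mathcomp Require Import ring lra zify.
From mathcomp Require boolp.

Set Implicit Arguments.
Unset Strict Implicit.
Unset Printing Implicit Defensive.

Import Order.TTheory GRing.Theory Num.Theory.
Local Open Scope ring_scope.

(** * Edge loads and threshold sets *)

Section LevelSets.
Variable G : finType.

Definition degree (E : rel G) (v : G) : nat := \sum_w E v w.

(* Ordered pairs: every edge of a symmetric [E] counts twice. *)
Definition edges_within (E : rel G) (U : {set G}) : nat :=
  \sum_(v in U) \sum_(w in U) E v w.

(** By symmetry, the edges leaving [U] are counted in the degrees outside [U]. This turns degree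
    sums, which can be aggregated vertex by vertex, into a bound on the edges inside [U]. *)
Lemma edges_within_ge (E : rel G) (U : {set G}) : symmetric E ->
  (\sum_(v in U) degree E v <=
   edges_within E U + \sum_(v in ~: U) degree E v)%N.
Proof.
move=> symE; rewrite /edges_within /degree.
have -> : (\sum_(v in U) \sum_w E v w =
    \sum_(v in U) \sum_(w in U) E v w +
    \sum_(v in U) \sum_(w in ~: U) E v w)%N.
  rewrite -big_split /=; apply: eq_bigr => v _.
  by rewrite (bigID (mem U)) /=; congr addn; apply: eq_bigl => w; rewrite inE.
rewrite leq_add2l exchange_big /=; apply: leq_sum => v _.
rewrite [leqRHS](bigID (mem U)) /= -[leqLHS]addn0 leq_add //.
by apply: leq_sum => w _; rewrite symE.
Qed.

End LevelSets.

(** * Multiplicative weights: all edges get covered as long as no threshold set is dense *)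

Section Coverage.
Variables (R : realType) (G : finType) (lv : rel G).
Variables (K eta a : R) (T J : nat) (cov f : nat -> G -> G -> R).
Hypothesis lv_sym : symmetric lv.
Hypothesis cov0 : forall v w, cov 0%N v w = 0.
Hypothesis covS :
  forall t v w, cov t.+1 v w = cov t v w + (f t v w + f t w v).
Hypothesis f01 : forall t v w, 0 <= f t v w <= 1.
Hypothesis f_cap : forall t v, \sum_(w | lv v w) f t v w <= K.

Definition level (t : nat) (th : R) : rel G :=
  fun v w => lv v w && (cov t v w <= th).

(** The load guaranteed to every edge after [t] rounds; [a] pays for the initial potential. *)
Definition level_floor (t : nat) : R := (1 - 4 * eta) * t%:R - a.

Hypothesis f_greedy : forall t v th,
  Num.min K (degree (level t th) v)%:R <= \sum_(w | level t th v w) f t v w.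

(** By [edges_within_ge] this forces more than [K] edges per vertex inside the threshold set. Degree
    sums are used because a vertex knows its own degree but not which neighbours belong to the
    set. *)
Definition dense_level (t : nat) (th : R) : bool :=
  2 * K * #|[set v | K < (degree (level t th) v)%:R]|%:R <
  (\sum_(v | K < (degree (level t th) v)%:R) degree (level t th) v)%:R -
  (\sum_(v | ~~ (K < (degree (level t th) v)%:R)) degree (level t th) v)%:R.

Hypothesis no_dense : forall t j, (t < T)%N -> (j < J)%N ->
  ~~ dense_level t (level_floor t + j%:R).
Hypothesis eta_gt0 : 0 < eta.
Hypothesis eta_le : eta <= 4^-1.
Hypothesis T_gt0 : (0 < T)%N.
Hypothesis a_large : #|G|%:R ^+ 2 <= expR (eta * a).
Hypothesis J_large : #|G|%:R ^+ 2 * expR (- (eta * J%:R)) <= eta.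
Hypothesis T_large : a <= eta * T%:R.

Lemma cov_sym t v w : cov t v w = cov t w v.
Proof.
by elim: t => [|t IH]; rewrite ?cov0 // !covS IH [f t v w + _]addrC.
Qed.

Lemma level_sym t th : symmetric (level t th).
Proof. by move=> v w; rewrite /level lv_sym cov_sym. Qed.

(* Weak duality for one threshold: with [U] the vertices whose level degree
   exceeds [K], the level has at most [K #|U|] edges inside [U] plus the degrees
   outside [U], and this is what the vertices hand out greedily. *)
Lemma level_covered t th : ~~ dense_level t th ->
  \sum_v \sum_w (level t th v w)%:R <=
  \sum_v \sum_(w | level t th v w) (f t v w + f t w v).
Proof.
set E := level t th; rewrite /dense_level -leNgt => nd.
have -> : \sum_v \sum_(w | E v w) (f t v w + f t w v) =
   2 * \sum_v \sum_(w | E v w) f t v w.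
  under eq_bigr do rewrite big_split /=.
  rewrite big_split /= mulr2n mulrDl mul1r; congr (_ + _).
  rewrite (exchange_big_dep predT) //=; apply: eq_bigr => v _.
  by apply: eq_bigl => w; rewrite /E level_sym.
have le1 : \sum_v Num.min K (degree E v)%:R <= \sum_v \sum_(w | E v w) f t v w.
  by apply: ler_sum => v _; exact: f_greedy.
have -> : \sum_v \sum_w (E v w)%:R = (\sum_v (degree E v)%:R : R).
  by apply: eq_bigr => v _; rewrite /degree natr_sum.
apply: le_trans (_ : 2 * \sum_v Num.min K (degree E v)%:R <= _); last first.
  by rewrite ler_pM2l.
move: nd; rewrite -/E.
rewrite !natr_sum (bigID (fun v => K < (degree E v)%:R) predT) /=.
rewrite [X in _ -> _ <= 2 * X](bigID (fun v => K < (degree E v)%:R)) /=.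
have -> : \sum_(i | K < (degree E i)%:R) Num.min K (degree E i)%:R =
   K * #|[set v | K < (degree E v)%:R]|%:R.
  rewrite (eq_bigr (fun=> K)) => [|v /ltW/min_idPl //].
  rewrite sumr_const mulr_natr; congr (_ *+ _).
  by apply: eq_card => v; rewrite !inE.
have -> : \sum_(i | ~~ (K < (degree E i)%:R)) Num.min K (degree E i)%:R =
  \sum_(i | ~~ (K < (degree E i)%:R)) (degree E i)%:R.
  by apply: eq_bigr => v; rewrite -leNgt => /min_idPr.
lra.
Qed.

Definition potential t : R :=
  \sum_v \sum_(w | lv v w) expR (- (eta * cov t v w)).

(* A step function of [s] between [expR (- eta) * expR (- eta * s)], up to a
   negligible constant, and [expR (- eta * s)]; being a positive combination of
   threshold indicators, it inherits [level_covered]. *)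
Let stepw t s : R := \sum_(j < J)
  if s <= level_floor t + j%:R
  then expR (- (eta * (level_floor t + j%:R))) -
       expR (- (eta * (level_floor t + j.+1%:R))) else 0.

Let E_ t j := expR (- (eta * (level_floor t + j%:R))).

Let E_dec t j : E_ t j.+1 <= E_ t j.
Proof. by rewrite /E_ ler_expR lerN2 ler_pM2l // lerD2l ler_nat. Qed.

Let stepw_le t s : stepw t s <= expR (- (eta * s)).
Proof.
set y := expR _.
suff: stepw t s <= Num.max (y - E_ t J) 0.
  move=> /le_trans; apply; rewrite ge_max expR_ge0 andbT.
  by rewrite lerBlDr lerDl expR_ge0.
rewrite /stepw; elim: J => [|j IH]; first by rewrite big_ord0 le_max lexx orbT.
rewrite big_ord_recr /=; case: ifP => [les|_].
  rewrite le_max; apply/orP; left.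
  have yE : E_ t j <= y by rewrite /y ler_expR lerN2 ler_pM2l.
  move: IH; have -> : Num.max (y - E_ t j) 0 = y - E_ t j.
    by apply/max_idPl; rewrite subr_ge0.
  rewrite -/(E_ t j) -/(E_ t j.+1); lra.
rewrite addr0; apply: (le_trans IH).
by apply: (@le_max2 _ R) => //; rewrite lerD2l lerN2.
Qed.

(** The hypothesis says that [s] is at least [level_floor t], so the first threshold not below [s]
    exceeds it by less than 1. This unit gap costs the factor [expR (- eta)], and stopping after [J]
    thresholds costs [E_ t J]. *)
Let stepw_ge t s : expR (- (eta * s)) <= expR (- (eta * level_floor t)) ->
  expR (- eta) * expR (- (eta * s)) - E_ t J <= stepw t s.
Proof.
set y := expR (- (eta * s)) => yle; rewrite /stepw.
elim: J => [|j IH].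
  rewrite big_ord0 subr_le0 /E_ addr0; apply: le_trans yle.
  by rewrite ler_piMl ?expR_ge0 // -[leRHS]expR0 ler_expR oppr_le0 ltW.
rewrite big_ord_recr /=; case: ifP => [_|/negbT].
  rewrite -/(E_ t j) -/(E_ t j.+1); lra.
rewrite -ltNge => lts; rewrite addr0; apply: le_trans (_ : 0 <= _); last first.
  by apply: sumr_ge0 => i _; case: ifP => // _; rewrite subr_ge0 E_dec.
rewrite subr_le0 /E_ /y -expRD ler_expR -opprD lerN2.
rewrite -[X in _ <= X + _]mulr1 -mulrDr ler_pM2l // -natr1; lra.
Qed.

(** From [expR (- z) <= (1 + z)^-1] with [z = eta * x]. The bound 2 is the width of the game: each
    endpoint gives an edge at most one unit. *)
Let exp_step (x : R) : 0 <= x <= 2 ->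
  expR (- (eta * x)) <= 1 - eta * (1 - 2 * eta) * x.
Proof.
move=> /andP[x0 x2].
have ex0 : 0 <= eta * x by rewrite mulr_ge0 // ltW.
have p1 : 0 < 1 + eta * x by lra.
apply: le_trans (_ : (1 + eta * x)^-1 <= _).
  by rewrite expRN lef_pV2 ?posrE ?expR_gt0 // expR_ge1Dx.
rewrite -[X in X <= _]mul1r ler_pdivrMr //.
have h : eta * x <= 2 * eta by rewrite mulrC ler_wpM2r // ltW.
have h2 : 0 <= (2 * eta - eta * x) * (eta * x) by rewrite mulr_ge0 // subr_ge0.
have h3 : 0 <= eta * eta * x * (eta * x).
  by rewrite mulr_ge0 // mulr_ge0 // mulr_ge0 // ltW.
nra.
Qed.

Lemma potential_step t : (t < T)%N ->
  potential t <= expR (- (eta * level_floor t)) ->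
  potential t.+1 <= expR (- (eta * level_floor t.+1)).
Proof.
move=> tT potle; set Bt := expR _ in potle.
pose y v w := expR (- (eta * cov t v w)).
pose F v w := f t v w + f t w v.
(* One summand is at most the whole potential, so every edge has load at least [level_floor t], as
   [stepw_ge] requires. *)
have y_le v w : lv v w -> y v w <= Bt.
  move=> lvw; apply: le_trans potle.
  rewrite /potential (bigD1 v) //= (bigD1 w) //= -addrA lerDl.
  rewrite addr_ge0 ?sumr_ge0 // => [i _|i _]; first exact: expR_ge0.
  by apply: sumr_ge0 => j _; exact: expR_ge0.
have F02 v w : 0 <= F v w <= 2.
  have /andP[? ?] := f01 t v w; have /andP[? ?] := f01 t w v.
  rewrite /F; lra.
pose eta' := eta * (1 - 2 * eta).
have eta'0 : 0 <= eta' by rewrite mulr_ge0 ?(ltW eta_gt0) //; have := eta_le; lra.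
have step1 : potential t.+1 <=
   potential t - eta' * \sum_v \sum_(w | lv v w) stepw t (cov t v w) * F v w.
  rewrite /potential mulr_sumr -sumrB ler_sum // => v _.
  rewrite mulr_sumr -sumrB ler_sum // => w lvw.
  rewrite covS mulrDr opprD expRD -/(F v w).
  apply: le_trans (_ : y v w * (1 - eta' * F v w) <= _).
    by rewrite ler_wpM2l ?expR_ge0 // exp_step.
  have /andP[F0 _] := F02 v w.
  have h1 : stepw t (cov t v w) * F v w <= y v w * F v w.
    by rewrite ler_wpM2r // stepw_le.
  have h2 := ler_wpM2l eta'0 h1.
  rewrite -/(y v w); nra.
(* Exchanging sums makes both sides the same nonnegative combination of sums over threshold graphs,
   to each of which [level_covered] applies. *)
have step2 : \sum_v \sum_(w | lv v w) stepw t (cov t v w) <=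
   \sum_v \sum_(w | lv v w) stepw t (cov t v w) * F v w.
  pose wt (j : nat) := E_ t j - E_ t j.+1.
  have aux (H : G -> G -> R) :
     \sum_v \sum_(w | lv v w) stepw t (cov t v w) * H v w =
     \sum_(j < J) wt j *
       \sum_v \sum_(w | level t (level_floor t + j%:R) v w) H v w.
    under eq_bigr do under eq_bigr do rewrite mulr_suml.
    under eq_bigr do rewrite exchange_big /=.
    rewrite exchange_big /=; apply: eq_bigr => j _.
    rewrite mulr_sumr; apply: eq_bigr => v _; rewrite mulr_sumr.
    rewrite /level big_mkcondr; apply: eq_bigr => w _.
    by case: ifP => _; rewrite ?mul0r.
  have -> : \sum_v \sum_(w | lv v w) stepw t (cov t v w) =
     \sum_v \sum_(w | lv v w) stepw t (cov t v w) * 1.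
    by under [RHS]eq_bigr do under eq_bigr do rewrite mulr1.
  rewrite !aux; apply: ler_sum => j _.
  apply: ler_wpM2l; first by rewrite subr_ge0 E_dec.
  have := level_covered (no_dense tT (ltn_ord j)).
  congr (_ <= _); apply: eq_bigr => v _.
  by rewrite [RHS]big_mkcond /=; apply: eq_bigr => w _; case: (level _ _ _ _).
have step3 : expR (- eta) * potential t - #|G|%:R ^+ 2 * E_ t J <=
   \sum_v \sum_(w | lv v w) stepw t (cov t v w).
  have h1 : \sum_(v : G) \sum_(w | lv v w) E_ t J <= #|G|%:R ^+ 2 * E_ t J.
    apply: le_trans (_ : \sum_(v : G) \sum_(w : G) E_ t J <= _).
      apply: ler_sum => v _; rewrite big_mkcond; apply: ler_sum => w _.
      by case: ifP => // _; exact: expR_ge0.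
    by rewrite !sumr_const -mulrnA -[leLHS]mulr_natl natrM expr2.
  apply: le_trans (lerB (lexx _) h1) _.
  rewrite /potential mulr_sumr -sumrB; apply: ler_sum => v _.
  rewrite mulr_sumr -sumrB; apply: ler_sum => w lvw.
  exact/stepw_ge/y_le.
have step4 : #|G|%:R ^+ 2 * E_ t J <= eta * Bt.
  rewrite /E_ mulrDr opprD expRD -/Bt mulrCA [leRHS]mulrC.
  by rewrite ler_wpM2l // expR_ge0.
have Bt0 : 0 <= Bt by exact: expR_ge0.
have -> : expR (- (eta * level_floor t.+1)) = Bt * expR (- (eta * (1 - 4 * eta))).
  by rewrite /Bt -expRD /level_floor -natr1; congr expR; ring.
set g := expR (- eta) in step3.
have g1 : 1 - eta <= g by apply: le_trans (expR_ge1Dx _).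
have g1' : g <= 1 by rewrite /g -[leRHS]expR0 ler_expR oppr_le0 ltW.
have h5 : 1 - eta * (1 - 4 * eta) <= expR (- (eta * (1 - 4 * eta))).
  by apply: le_trans (expR_ge1Dx _).
apply: le_trans (ler_wpM2l Bt0 h5).
apply: (le_trans step1).
have h6 := ler_wpM2l eta'0 (le_trans step3 step2).
have p0 : 0 <= 1 - eta' * g.
  have h12 : eta' * g <= eta' by rewrite ler_piMr.
  have h13 : eta' <= eta by rewrite /eta' ler_piMr ?(ltW eta_gt0) //; have := eta_gt0; lra.
  by have := eta_le; lra.
have h8 : (1 - eta' * g) * potential t <= (1 - eta' * g) * Bt by rewrite ler_wpM2l.
have h9 := ler_wpM2l eta'0 step4.
have h10 : eta' * (1 - eta) * Bt <= eta' * g * Bt.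
  by rewrite ler_wpM2r // ler_wpM2l.
(* The right side is [eta * (1 - 2 * eta) ^+ 2]; this is where the constant 4 of [level_floor] comes
   from. *)
have h11 : eta * (1 - 4 * eta) <= eta' * (1 - eta) - eta' * eta.
  rewrite /eta' -mulrA -mulrA -mulrBr ler_pM2l //.
  have := sqr_ge0 eta; nra.
have h12 := ler_wpM2r Bt0 h11.
nra.
Qed.

Lemma potential_le t : (t <= T)%N ->
  potential t <= expR (- (eta * level_floor t)).
Proof.
elim: t => [_|t IH tT]; last by apply: potential_step => //; exact/IH/ltnW.
rewrite /level_floor mulr0 sub0r mulrN opprK; apply: le_trans a_large.
apply: le_trans (_ : \sum_(v : G) \sum_(w : G) 1 <= _).
  rewrite /potential; apply: ler_sum => v _; rewrite big_mkcond /=.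
  by apply: ler_sum => w _; case: ifP => // _; rewrite cov0 mulr0 oppr0 expR0.
by rewrite !sumr_const -mulrnA -natrX -mulnn.
Qed.

Lemma cov_ge v w : lv v w -> level_floor T <= cov T v w.
Proof.
move=> lvw; rewrite -(ler_pM2l eta_gt0) -lerN2 -ler_expR.
apply: le_trans (potential_le (leqnn T)).
rewrite /potential (bigD1 v) //= (bigD1 w) //= -addrA lerDl.
rewrite addr_ge0 ?sumr_ge0 // => [i _|i _]; first exact: expR_ge0.
by apply: sumr_ge0 => j _; exact: expR_ge0.
Qed.

(** Double counting of the load on the edges of [E] inside [U]: each has at least [level_floor T],
    while each vertex of [U] hands out at most [K] per round, counted twice over ordered pairs.
    [T_large] absorbs [a] by raising the loss from [4 * eta] to [5 * eta]. *)
Lemma sparse_of_no_dense (E : rel G) (U : {set G}) : symmetric E ->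
  subrel E lv ->
  (1 - 5 * eta) * (edges_within E U)%:R <= 2 * K * #|U|%:R.
Proof.
move=> symE subE.
have covE t v w : cov t v w = \sum_(i < t) (f i v w + f i w v).
  by elim: t => [|t IH]; rewrite ?big_ord0 // big_ord_recr /= covS IH.
pose E' v w := [&& v \in U, w \in U & E v w].
have E'E : ((edges_within E U)%:R : R) = \sum_v \sum_(w | E' v w) 1.
  rewrite /edges_within natr_sum big_mkcond /=; apply: eq_bigr => v _.
  rewrite /E' natr_sum; case: (v \in U); last by rewrite big_pred0.
  by rewrite /= [RHS]big_mkcondr /=; apply: eq_bigr => w _; case: (E v w).
have lo : level_floor T * (edges_within E U)%:R <=
    \sum_v \sum_(w | E' v w) cov T v w.
  rewrite E'E mulr_sumr; apply: ler_sum => v _.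
  rewrite mulr_sumr; apply: ler_sum => w /and3P[_ _ Evw].
  by rewrite mulr1; exact/cov_ge/subE.
have hi : \sum_v \sum_(w | E' v w) cov T v w <= 2 * K * #|U|%:R * T%:R.
  have -> : \sum_v \sum_(w | E' v w) cov T v w =
      \sum_(i < T) 2 * \sum_v \sum_(w | E' v w) f i v w.
    under eq_bigr do under eq_bigr do rewrite covE.
    under eq_bigr do rewrite exchange_big /=.
    rewrite exchange_big /=; apply: eq_bigr => i _.
    under eq_bigr do rewrite big_split /=.
    rewrite big_split /= mulr2n mulrDl mul1r; congr (_ + _).
    rewrite (exchange_big_dep predT) //=; apply: eq_bigr => v _.
    by apply: eq_bigl => w; rewrite /E' symE andbCA.
  have -> : 2 * K * #|U|%:R * T%:R = \sum_(i < T) 2 * (K * #|U|%:R).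
    by rewrite sumr_const card_ord mulr_natr -mulrA.
  apply: ler_sum => i _; rewrite ler_pM2l //.
  have -> : K * #|U|%:R = \sum_(v in U) K by rewrite sumr_const mulr_natr.
  rewrite [leRHS]big_mkcond /=; apply: ler_sum => v _; rewrite /E'.
  case: (v \in U); last by rewrite big_pred0.
  apply: le_trans (f_cap i v); rewrite [leLHS]big_mkcond [leRHS]big_mkcond /=.
  apply: ler_sum => w _; have /andP[f0 _] := f01 i v w.
  case: ifP => [/andP[_ /subE ->] //|_]; by case: ifP.
have := le_trans lo hi; rewrite /level_floor => h.
have e0 : 0 <= ((edges_within E U)%:R : R) by [].
have T0 : 0 < (T%:R : R) by rewrite ltr0n.
rewrite -(ler_pM2r T0); apply: le_trans h.
have := ler_wpM2r e0 T_large; nra.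
Qed.
End Coverage.

(** * Subgraphs and the density threshold *)

Section EdgeCounting.
Variable G : sgraph.

Lemma edges_pair (v w : G) : ([set v; w] \in edges G) = edge v w.
Proof.
apply/imsetP/idP => [[[a b] /= ab]|vw]; last by exists (v, w); rewrite ?inE.
rewrite inE /= in ab => E.
have va : (v == a) || (v == b) by rewrite -in_set2 -E !inE eqxx.
have wa : (w == a) || (w == b) by rewrite -in_set2 -E !inE eqxx orbT.
have av : (a == v) || (a == w) by rewrite -in_set2 E !inE eqxx.
have bv : (b == v) || (b == w) by rewrite -in_set2 E !inE eqxx orbT.
have nab : a != b by apply: contraTneq ab => ->; rewrite edge_irrefl.
case/orP: va wa av bv => /eqP-> /orP[/eqP->|/eqP->] //.
- by rewrite !orbb (eq_sym b) (negbTE nab).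
- by rewrite edge_sym.
- by rewrite !orbb (negbTE nab).
Qed.

Lemma edge_set_double (F : {set {set G}}) : F \subset edges G ->
  (\sum_(v : G) \sum_(w : G) ([set v; w] \in F) = 2 * #|F|)%N.
Proof.
move=> /subsetP sF; rewrite pair_big /=.
rewrite (eq_bigr (fun p : G * G => if [set p.1; p.2] \in F then 1 else 0)%N);
  last by move=> p _; case: (_ \in F).
rewrite -big_mkcond /=.
rewrite (partition_big (fun p : G * G => [set p.1; p.2]) (mem F)) //=.
rewrite -sum1_card big_distrr /=; apply: eq_bigr => e eF.
have /imsetP[[a b] /=] := sF _ eF; rewrite inE /= => ab ee; subst e.
have nab : a != b by apply: contraTneq ab => ->; rewrite edge_irrefl.
rewrite sum1dep_card muln1.
have -> : [set x : G * G | ([set x.1; x.2] \in F) && ([set x.1; x.2] == [set a; b])]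
    = [set (a, b); (b, a)].
  apply/setP => [[v w]]; rewrite !inE /= !xpair_eqE.
  apply/idP/idP => [/andP[_ /eqP E]|]; last first.
    by move=> /orP[]/andP[/eqP-> /eqP->]; rewrite ?eF ?eqxx // setUC eF eqxx.
  have va : (v == a) || (v == b) by rewrite -in_set2 -E !inE eqxx.
  have wa : (w == a) || (w == b) by rewrite -in_set2 -E !inE eqxx orbT.
  have av : (a == v) || (a == w) by rewrite -in_set2 E !inE eqxx.
  have bv : (b == v) || (b == w) by rewrite -in_set2 E !inE eqxx orbT.
  case/orP: va wa av bv => /eqP-> /orP[/eqP->|/eqP->]; rewrite ?eqxx ?orbT //.
  + by rewrite !orbb (eq_sym b) (negbTE nab).
  + by rewrite !orbb (negbTE nab).
by rewrite cards2 xpair_eqE negb_and nab.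
Qed.

Lemma card_induced (U : {set G}) :
  (edges_within (@edge G) U = 2 * #|(induced U).2|)%N.
Proof.
rewrite -edge_set_double; last by apply/subsetP => f; rewrite inE => /andP[].
rewrite /edges_within big_mkcond /=; apply: eq_bigr => v _.
case vU: (v \in U); last first.
  by rewrite big1 // => w _; rewrite inE subUset sub1set vU /= andbF.
rewrite big_mkcond /=; apply: eq_bigr => w _.
rewrite inE subUset !sub1set vU edges_pair /=.
by case: (w \in U); rewrite ?andbT ?andbF.
Qed.

Lemma edges_within_le_sqr (E : rel G) (U : {set G}) :
  (edges_within E U <= #|G| ^ 2)%N.
Proof.
rewrite /edges_within (leq_trans (n := \sum_(v : G) \sum_(w : G) 1)) //; last first.
  by rewrite !sum_nat_const muln1 mulnn.
rewrite big_mkcond; apply: leq_sum => v _; case: ifP => // _.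
rewrite big_mkcond; apply: leq_sum => w _; case: ifP => // _; exact: leq_b1.
Qed.

(** Positivity of [x] excludes the default value 0 of the maximum, so some subgraph attains density
    [x]. It need not be induced, hence the relation [E]; its edge number [m] is kept for comparing
    densities as fractions. *)
Lemma max_density_witness (R : realType) (x : R) : 0 < x -> x <= max_density R G ->
  exists U : {set G}, exists E : rel G,
  [/\ symmetric E, subrel E (@edge G), (0 < #|U|)%N &
   2 * x * #|U|%:R <= (edges_within E U)%:R /\
   exists2 m : nat, (edges_within E U = 2 * m)%N & (m <= #|G| ^ 2)%N].
Proof.
move=> x0 xle.
have /exists_inP[H] :
    [exists (H : {set G} * {set {set G}} | is_subgraph H && (H.1 != set0)),
       x <= density R H].
  apply: contraLR xle; rewrite negb_exists_in => /forall_inP nH.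
  rewrite -ltNge; apply/bigmax_ltP; split => // H HH.
  by rewrite ltNge; exact: nH.
case: H => U F /= /andP[/andP[/= sF /forall_inP FU] U0] /= xH.
exists U, (fun v w => [set v; w] \in F).
have E2 : edges_within (fun v w => [set v; w] \in F) U = (2 * #|F|)%N.
  rewrite -edge_set_double // /edges_within big_mkcond /=; apply: eq_bigr => v _.
  case vU: (v \in U); last first.
    rewrite big1 // => w _; case e: (_ \in F) => //.
    by have := FU _ e; rewrite subUset sub1set vU.
  rewrite big_mkcond /=; apply: eq_bigr => w _.
  case e: (_ \in F); last by rewrite if_same.
  by have := FU _ e; rewrite subUset !sub1set => /andP[_ ->].
have cU : (0 < #|U|)%N by rewrite card_gt0.
split => //.
- by move=> v w; rewrite setUC.
- by move=> v w /(subsetP sF); rewrite edges_pair.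
- split; last first.
    exists #|F|; first exact: E2.
    rewrite -(leq_pmul2l (isT : 0 < 2)%N) -E2.
    by rewrite (leq_trans (edges_within_le_sqr _ _)) // leq_pmull.
  rewrite E2 natrM -mulrA ler_pM2l //.
  by move: xH; rewrite /density /= ler_pdivlMr // ltr0n.
Qed.

End EdgeCounting.

(** * Densities as fractions with bounded denominators *)

Section Capacity.
Variable R : realType.

(* All densities are rationals with denominator at most [n], so that an accuracy
   below [n ^- 4] is never needed; this keeps every counter polynomial in [n]. *)
Definition eps_floor (n : nat) (eps : R) : R := Num.max eps (n%:R ^- 4).

(* The largest density smaller than [Dt] of a graph on [n] vertices. *)
Definition density_below (n : nat) (Dt : R) : R :=
  \big[Num.max/0]_(p : 'I_(n ^ 2).+1 * 'I_n.+1 |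
     (0 < p.2)%N && (p.1%:R / p.2%:R < Dt)) (p.1%:R / p.2%:R).

(* For tiny [eps] the goal is a density at least [Dt]; the gap of order [n ^- 2]
   between different densities is then used in place of [eps]. *)
Definition capacity (n : nat) (Dt eps : R) : R :=
  if n%:R ^- 4 <= eps then (1 - eps) * Dt
  else density_below n Dt + (2 * n%:R ^+ 2)^-1.

Variables (n : nat) (Dt eps : R).
Hypotheses (n_gt1 : (1 < n)%N) (Dt_gt0 : 0 < Dt) (eps01 : 0 < eps < 1).

Lemma density_belowP : exists a b : nat,
  [/\ (0 < b <= n)%N, density_below n Dt = a%:R / b%:R & density_below n Dt < Dt].
Proof.
rewrite /density_below; elim/big_ind: _ => [|x y [a [b [? -> ?]]] [c [d [? -> ?]]]|].
- by exists 0%N, 1%N; rewrite mul0r; split=> //; exact: ltnW.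
- by case: (leP (a%:R / b%:R) (c%:R / d%:R)) => _; [exists c, d|exists a, b].
- by move=> [a b] /= /andP[b0 ab]; exists a, b; rewrite b0 -ltnS ltn_ord.
Qed.

Let n0 : 0 < (n%:R : R).
Proof. by rewrite ltr0n ltnW. Qed.

Lemma eps_floor_bounds :
  [/\ 0 < eps_floor n eps, eps_floor n eps < 1,
      eps <= eps_floor n eps & n%:R ^- 4 <= eps_floor n eps].
Proof.
have /andP[e0 e1] := eps01; rewrite /eps_floor lt_max e0 gt_max e1 !le_max !lexx orbT.
by split => //; rewrite invf_lt1 ?exprn_gt0 // exprn_egt1 // ltr1n.
Qed.

Lemma capacity_ge0 : 0 <= capacity n Dt eps.
Proof.
have /andP[e0 e1] := eps01; rewrite /capacity; case: ifP => _.
  by rewrite mulr_ge0 ?(ltW Dt_gt0) // subr_ge0 ltW.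
have [a [b [? -> _]]] := density_belowP.
by rewrite addr_ge0 ?divr_ge0 // invr_ge0 mulr_ge0 // exprn_ge0 // ltW.
Qed.

(** For tiny [eps] the capacity exceeds [density_below], so a fraction reaching it cannot lie below
    [Dt]. *)
Lemma capacity_sound (a b : nat) : (0 < b <= n)%N -> (a <= n ^ 2)%N ->
  capacity n Dt eps * b%:R <= a%:R -> (1 - eps) * Dt <= a%:R / b%:R.
Proof.
have /andP[e0 e1] := eps01.
move=> /andP[b0 bn] an; have b0' : 0 < (b%:R : R) by rewrite ltr0n.
rewrite -ler_pdivlMr // /capacity; case: ifP => // _ h.
have n2 : 0 < (2 * n%:R ^+ 2)^-1 :> R by rewrite invr_gt0 mulr_gt0 // exprn_gt0.
apply: le_trans (_ : Dt <= _).
  by rewrite ler_piMl ?(ltW Dt_gt0) //; lra.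
rewrite leNgt; apply/negP => lt.
have : a%:R / b%:R <= density_below n Dt.
  have an' : (a < (n ^ 2).+1)%N by [].
  have bn' : (b < n.+1)%N by [].
  pose p : 'I_(n ^ 2).+1 * 'I_n.+1 := (Ordinal an', Ordinal bn').
  rewrite -[a%:R / _]/((p.1)%:R / (p.2)%:R).
  apply: (le_bigmax_cond 0 (fun p : 'I_(n ^ 2).+1 * 'I_n.+1 => p.1%:R / p.2%:R)).
  by rewrite /= b0.
lra.
Qed.

(** For tiny [eps], integrality gives [a' * b + 1 <= a * b'] and hence the margin [n^-1] in [h2].
    The surplus in the capacity ([h3]) and the relative loss [n ^- 4] ([h4]) use at most half of it
    each. *)
Lemma capacity_complete (a b : nat) : (0 < b <= n)%N -> (a <= n ^ 2)%N ->
  Dt * b%:R <= a%:R -> capacity n Dt eps * b%:R <= (1 - eps_floor n eps) * a%:R.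
Proof.
have /andP[e0 e1] := eps01.
move=> /andP[b0 bn] an h; have b0' : 0 < (b%:R : R) by rewrite ltr0n.
rewrite /capacity /eps_floor; case: (leP (n%:R ^- 4) eps) => c.
  by rewrite -mulrA ler_wpM2l // subr_ge0 ltW.
have [a' [b' [/andP[b'0 b'n] dE dlt]]] := density_belowP.
have b'0' : 0 < (b'%:R : R) by rewrite ltr0n.
have h1 : a'%:R * b%:R + 1 <= a%:R * b'%:R :> R.
  have : a'%:R * b%:R < a%:R * b'%:R :> R.
    have d1 : a'%:R < Dt * b'%:R by move: dlt; rewrite dE ltr_pdivrMr.
    have d2 : a'%:R * b%:R < Dt * b'%:R * b%:R by rewrite ltr_pM2r.
    have d3 : Dt * b%:R * b'%:R <= a%:R * b'%:R by rewrite ler_pM2r.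
    by apply: lt_le_trans d2 _; rewrite mulrAC.
  by rewrite -!natrM ltr_nat natr1 ler_nat.
have h2 : density_below n Dt * b%:R <= a%:R - n%:R^-1.
  rewrite dE mulrAC ler_pdivrMr // mulrBl; apply: le_trans (_ : a%:R * b'%:R - 1 <= _); first lra.
  rewrite lerD2l lerN2 mulrC ler_pdivrMr // mul1r ler_nat //.
have h3 : (2 * n%:R ^+ 2)^-1 * b%:R <= (2 * n%:R)^-1 :> R.
  rewrite expr2 mulrA invfM -mulrA ler_piMr ?invr_ge0 ?mulr_ge0 ?(ltW n0) //.
  by rewrite mulrC ler_pdivrMr // mul1r ler_nat.
have h4 : n%:R ^- 4 * a%:R <= (2 * n%:R)^-1 :> R.
  rewrite mulrC ler_pdivrMr ?exprn_gt0 //.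
  apply: le_trans (_ : n%:R ^+ 2 <= _); first by rewrite -natrX ler_nat.
  rewrite mulrC ler_pdivlMr ?mulr_gt0 //.
  have n2 : 2 <= n%:R :> R by rewrite ler_nat.
  rewrite (_ : n%:R ^+ 4 = n%:R ^+ 2 * (n%:R * n%:R)); last ring.
  by rewrite ler_pM2l ?exprn_gt0 // ler_pM2r.
have h5 : (2 * n%:R)^-1 + (2 * n%:R)^-1 = n%:R^-1 :> R.
  by field; rewrite gt_eqF.
lra.
Qed.

End Capacity.

(** * Random shifts *)

Section Resample.
Variables (G Om : finType).

Definition resample (w : {ffun G -> Om}) (u : G) (x : Om) : {ffun G -> Om} :=
  [ffun v => if v == u then x else w v].

Lemma resampleE w u x : resample w u x u = x.
Proof. by rewrite ffunE eqxx. Qed.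

Lemma resample_neq w u x v : v != u -> resample w u x v = w v.
Proof. by rewrite ffunE => /negbTE->. Qed.

(** Exchanging the coordinate at [u] with the fresh value is an involution, so resampling preserves
    the uniform distribution. *)
Lemma sum_resample (u : G) (F : {ffun G -> Om} -> nat) :
  (\sum_w \sum_x F (resample w u x) = #|Om| * \sum_w F w)%N.
Proof.
pose swap (p : {ffun G -> Om} * Om) := (resample p.1 u p.2, p.1 u).
have swapK : cancel swap swap.
  case=> w x; rewrite /swap /= resampleE; congr pair.
  by apply/ffunP => v; rewrite !ffunE; case: eqP => // ->.
rewrite pair_big /= (reindex swap) /=; last first.
  by exists swap => p _; exact: swapK.
rewrite (eq_bigr (fun p => F p.1)); last first.
  move=> [w x] _ /=; congr F.
  by apply/ffunP => v; rewrite !ffunE; case: eqP => // ->.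
rewrite -(pair_big predT predT (fun w (x : Om) => F w)) /=.
by rewrite big_distrr; apply: eq_bigr => w _; rewrite sum_nat_const.
Qed.
End Resample.

(** * Probability that the best shifted score leads by less than 3 *)

Section Gap.
Variables (R : realType) (G Om : finType) (rho : Om -> nat) (d1 d2 : R).
Hypothesis rho_tail : forall j,
  #|[set x | (j <= rho x < j + 3)%N]|%:R <=
  d1 * #|[set x | (j <= rho x)%N]|%:R + d2 * #|Om|%:R.
Variables (id : G -> nat) (c : nat) (d : G -> nat).
Hypothesis id_inj : injective id.

(** Shift minus distance, made a natural number by the cap [c]. Distances will themselves be capped
    at [c], so truncation loses nothing. *)
Definition score (w : {ffun G -> Om}) (u : G) : nat := rho (w u) + (c - d u).

Definition has_gap (w : {ffun G -> Om}) : bool :=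
  [exists u, forall u', (u' != u) ==> (score w u' + 3 <= score w u)%N].

(* Ties are broken by ID. *)
Let wins (u : G) (w : {ffun G -> Om}) : bool :=
  [forall u', (u' != u) ==> (score w u' + (id u < id u') <= score w u)%N].

Let exists_winner (v0 : G) w : [exists u, wins u w].
Proof.
pose m := (\max_u (id u)).+1.
pose u := [arg max_(u > v0) (score w u * m + id u)%N].
apply/existsP; exists u; apply/forallP => u'; apply/implyP => u'u.
move: u'u; rewrite /u; case: arg_maxnP => //= v _ vmax u'u.
have := vmax u' isT; have := id_inj.
have : (id u' < m)%N by rewrite /m ltnS; exact: leq_bigmax.
have : (id v < m)%N by rewrite /m ltnS; exact: leq_bigmax.
have : id u' != id v by rewrite (inj_eq id_inj).
move: (id v) (id u') (score w v) (score w u') => a b p q ab am bm _ h.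
case: (ltnP a b) => ltab /=; last by rewrite addn0; nia.
by rewrite addn1; nia.
Qed.

(** The smallest shift with which [u] wins, given the shifts of the others. *)
Let lead u w := \max_(u' | u' != u) (score w u' + (id u < id u') - (c - d u)).

Let lead_resample u w x : lead u (resample w u x) = lead u w.
Proof. by apply: eq_bigr => u' u'u; rewrite /score resample_neq. Qed.

Let winsE u w : wins u w = (lead u w <= rho (w u))%N.
Proof.
apply/forallP/bigmax_leqP => [h u' u'u|h u'].
  have := implyP (h u') u'u.
  by rewrite [X in (_ <= X)%N -> _]/score; move: (nat_of_bool _) => b; lia.
apply/implyP => u'u; have := h u' u'u.
by rewrite [X in _ -> (_ <= X)%N]/score; move: (nat_of_bool _) => b; lia.
Qed.

Let gap_of_lead u w : (lead u w + 3 <= rho (w u))%N -> has_gap w.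
Proof.
move=> h; apply/existsP; exists u; apply/forallP => u'; apply/implyP => u'u.
have : (score w u' + (id u < id u') - (c - d u) <= lead u w)%N.
  exact: (@leq_bigmax_cond _ (fun u' => u' != u)
     (fun u' => (score w u' + (id u < id u') - (c - d u))%N)).
rewrite [X in _ -> (_ <= X)%N]/score; move: (nat_of_bool _) => b; lia.
Qed.

(* Memorylessness: resampling the shift of [u] alone, [u] wins iff its shift
   reaches [lead u w], and the gap is missing only if it exceeds it by at most 2. *)
Lemma card_no_gap (v0 : G) :
  #|[set w | ~~ has_gap w]|%:R <=
  (d1 + #|G|%:R * d2) * #|{: {ffun G -> Om}}|%:R.
Proof.
pose N := #|Om|; pose M := #|{: {ffun G -> Om}}|.
have [N0|Npos] := posnP N.
  have -> : #|[set w | ~~ has_gap w]| = 0%N.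
    apply: eq_card0 => w; have := fintype0 (w v0); rewrite -/N N0; by move=> /(_ erefl).
  have -> : #|{: {ffun G -> Om}}| = 0%N.
    apply: eq_card0 => w; have := fintype0 (w v0); rewrite -/N N0; by move=> /(_ erefl).
  by rewrite mulr0.
have Nr : 0 < (N%:R : R) by rewrite ltr0n.
pose bad u := (\sum_(w : {ffun G -> Om}) (wins u w && ~~ has_gap w))%N.
pose win u := (\sum_(w : {ffun G -> Om}) wins u w)%N.
have bad_le u : (bad u)%:R <= d1 * (win u)%:R + d2 * M%:R.
  rewrite -(ler_pM2l Nr) -natrM -(sum_resample u) mulrDr mulrCA -natrM -(sum_resample u).
  have -> : N%:R * (d2 * M%:R) = \sum_(w : {ffun G -> Om}) d2 * N%:R.
    by rewrite sumr_const -/M -[RHS]mulr_natr; ring.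
  rewrite !natr_sum mulr_sumr -big_split /=; apply: ler_sum => w _.
  apply: le_trans (_ : #|[set x | (lead u w <= rho x < lead u w + 3)%N]|%:R <= _).
    rewrite ler_nat -sum1dep_card [leqRHS]big_mkcond /=; apply: leq_sum => x _.
    rewrite winsE lead_resample resampleE; case: (leqP (lead u w) (rho x)) => //= _.
    case: (ltnP (rho x) (lead u w + 3)) => [_|h] /=; first exact: leq_b1.
    by rewrite (@gap_of_lead u) // resampleE lead_resample.
  apply: le_trans (rho_tail _) _; rewrite lerD2r.
  rewrite -sum1dep_card big_mkcond /=.
  rewrite (eq_bigr (fun x => nat_of_bool (wins u (resample w u x)))) // => x _.
  by rewrite winsE lead_resample resampleE; case: (lead u w <= rho x)%N.
apply: le_trans (_ : \sum_u (bad u)%:R <= _).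
  rewrite -natr_sum ler_nat /bad exchange_big -sum1dep_card big_mkcond /=.
  apply: leq_sum => w _; case: ifP => // ng.
  have /existsP[u wu] := exists_winner v0 w.
  by rewrite (bigD1 u) //= wu.
apply: le_trans (ler_sum _ (fun u _ => bad_le u)) _.
rewrite big_split /= -mulr_sumr -natr_sum sumr_const mulrDl.
(* With ties broken by ID, every outcome has exactly one winner. *)
have -> : (\sum_u win u = M)%N.
  rewrite /win exchange_big /M -sum1_card; apply: eq_bigr => w _.
  have /existsP[u wu] := exists_winner v0 w.
  rewrite (bigD1 u) //= wu big1 ?addn0 // => u' u'u; apply/eqP; rewrite eqb0.
  apply/negP => wu'.
  have /implyP/(_ u'u) := forallP wu u'.
  have := forallP wu' u; rewrite eq_sym u'u /=.
  have : id u != id u' by rewrite (inj_eq id_inj) eq_sym.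
  by case: ltngtP => //= _ _; lia.
rewrite -[_ *+ _]mulr_natr -/M; lra.
Qed.
End Gap.

(** * Low-diameter clustering *)

Section Clustering.
Local Open Scope nat_scope.
Variables (G : sgraph) (id : G -> nat) (B Rr : nat) (r : G -> nat).
Hypothesis id_inj : injective id.
Hypothesis id_lt : forall v, id v < B.
Hypothesis r_le : forall v, r v <= Rr.

(* The pair (shift, ID) in lexicographic order.  Moving a claim along an edge
   subtracts [B], i.e. lowers the shift by one; truncated subtraction turns an
   exhausted claim into the harmless value 0. *)
Definition key (v : G) : nat := r v * B + id v.

Fixpoint best (t : nat) (v : G) : nat :=
  if t is t'.+1
  then maxn (best t' v) (\max_(w | edge v w) (best t' w - B))
  else key v.

Definition claim (v : G) : nat := best Rr v.
Definition center (v : G) : nat := claim v %% B.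
(** What remains of the shift of the center on arrival at [v]. It drops by one along each tree edge
    away from the root, so heights are largest at roots. *)
Definition height (v : G) : nat := claim v %/ B.

Fixpoint inball (i : nat) (u v : G) : bool :=
  if i is i'.+1 then inball i' u v || [exists w, edge v w && inball i' u w]
  else u == v.

Lemma B_gt0 (v : G) : 0 < B.
Proof. by apply: leq_ltn_trans (id_lt v). Qed.

Lemma key_lt v : key v < Rr.+1 * B.
Proof.
rewrite /key; apply: (@leq_trans (r v * B + B)); first by rewrite ltn_add2l.
by rewrite -mulSnr leq_mul2r ltnS r_le orbT.
Qed.

Lemma best_ge t i u v : i <= t -> inball i u v -> key u - i * B <= best t v.
Proof.
elim: t i v => [|t IH] [|i] v //=.
- by move=> _ /eqP->; rewrite mul0n subn0.
- move=> _ uv; rewrite leq_max; apply/orP; left.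
  exact: (IH 0 v (leq0n t) uv).
- rewrite ltnS => it /orP[uv|/existsP[w /andP[vw uw]]]; rewrite leq_max.
    apply/orP; left; apply: leq_trans (IH _ _ it uv).
    by rewrite leq_sub2l // leq_mul2r leqnSn orbT.
  apply/orP; right.
  apply: (bigop.bigmax_sup w) => //; rewrite mulSnr subnDA leq_sub2r //; exact: IH.
Qed.

Lemma best_witness t v :
  exists u, exists2 i, i <= t & inball i u v /\ best t v = key u - i * B.
Proof.
elim: t v => [|t IH] v /=.
  by exists v, 0 => //=; rewrite mul0n subn0.
case: (leqP (\max_(w | edge v w) (best t w - B)) (best t v)) => h.
  have [u [i it [uv ->]]] := IH v.
  by exists u, i => //; rewrite (leq_trans it).
have [w vw] : exists2 w, edge v w &
    \max_(w | edge v w) (best t w - B) = best t w - B.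
  have : 0 < #|[pred w | edge v w]|.
    rewrite lt0n; apply: contraTneq h => /card0_eq e0.
    by rewrite big_pred0 // => w; have := e0 w; rewrite inE.
  by case/(eq_bigmax_cond (fun w => best t w - B)) => w; exists w.
have [u [i it [uw ->]] ->] := IH w.
exists u, i.+1 => //=; split; last by rewrite mulSnr subnDA.
by apply/orP; right; apply/existsP; exists w; rewrite vw.
Qed.

(** Keys are below [Rr.+1 * B], so after [Rr.+1] hops a claim is exhausted. *)
Lemma best_stable v : best Rr.+1 v = claim v.
Proof.
apply/eqP; rewrite eqn_leq leq_maxl andbT.
have [u [i + [uv ->]]] := best_witness Rr.+1 v.
rewrite leq_eqVlt => /orP[/eqP->|iR]; last exact: best_ge.
by apply: (@leq_trans 0) => //; rewrite leqn0 subn_eq0 ltnW // key_lt.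
Qed.

Lemma bestS t v :
  best t.+1 v = maxn (key v) (\max_(w | edge v w) (best t w - B)).
Proof.
elim: t v => [//|t IH] v; rewrite [LHS]/= -/(best t.+1 v) IH -maxnA.
congr maxn; apply/maxn_idPr/bigmax_leqP => w vw.
apply: (bigop.bigmax_sup w) => //; rewrite leq_sub2r //=; exact: leq_maxl.
Qed.

Lemma claimE v : claim v = maxn (key v) (\max_(w | edge v w) (claim w - B)).
Proof. by rewrite -best_stable bestS. Qed.

Lemma claim_lt v : claim v < Rr.+1 * B.
Proof.
rewrite /claim; have [u [i _ [_ ->]]] := best_witness Rr v.
by apply: leq_ltn_trans (key_lt u); exact: leq_subr.
Qed.

Lemma height_le v : height v <= Rr.
Proof. by rewrite /height -ltnS ltn_divLR ?(B_gt0 v) // claim_lt. Qed.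

Lemma center_lt v : center v < B.
Proof. by rewrite ltn_mod (B_gt0 v). Qed.

Definition is_root (v : G) : bool := center v == id v.

Lemma claim_parent v : ~~ is_root v ->
  exists2 w, edge v w & claim w = claim v + B.
Proof.
move=> nr; have nk : claim v != key v.
  apply: contraNneq nr => e; rewrite /is_root /center e /key.
  by rewrite modnMDl modn_small.
have kv : key v < claim v by rewrite ltn_neqAle eq_sym nk claimE leq_maxl.
have e : claim v = \max_(w | edge v w) (claim w - B).
  by have := claimE v; move: kv; lia.
have : 0 < #|[pred w | edge v w]|.
  rewrite lt0n; apply: contraTneq kv => /card0_eq e0.
  by rewrite e big_pred0 // => w; have := e0 w; rewrite inE.
case/(eq_bigmax_cond (fun w => claim w - B)) => w vw ew.
exists w => //; rewrite -e in ew; move: kv; lia.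
Qed.

Lemma parent_center v w : claim w = claim v + B -> center w = center v.
Proof. by move=> e; rewrite /center e modnDr. Qed.

Lemma parent_height v w : claim w = claim v + B -> height w = (height v).+1.
Proof.
by move=> e; rewrite /height e divnDr // divnn (B_gt0 v) addn1.
Qed.

Lemma root_uniq u v : is_root u -> is_root v -> center u = center v -> u = v.
Proof. by move=> /eqP-> /eqP->; exact: id_inj. Qed.

(* The graph distance, capped at [Rr + 1]. *)
Definition dist (u v : G) : nat := \sum_(i < Rr.+1) ~~ inball i u v.

Lemma inball_mono i j u v : i <= j -> inball i u v -> inball j u v.
Proof.
move=> /subnK<-; elim: (j - i) => [//|k IH] h.
by rewrite addSn /= IH.
Qed.

Lemma dist_le_cap u v : dist u v <= Rr.+1.
Proof.
apply: leq_trans (_ : \sum_(i < Rr.+1) 1 <= _); last by rewrite sum1_card card_ord.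
by apply: leq_sum => i _; exact: leq_b1.
Qed.

Lemma dist_le i u v : inball i u v -> dist u v <= i.
Proof.
move=> h; apply: leq_trans (_ : \sum_(j < Rr.+1) (j < i) <= _).
  apply: leq_sum => j _; case: ltnP => [_|ij]; first exact: leq_b1.
  by rewrite (inball_mono ij h).
elim: Rr => [|k IH]; first by rewrite big_ord_recr big_ord0 /=; case: i {h}.
rewrite big_ord_recr /=; case: ltnP => ki; last by rewrite addn0.
rewrite addn1; apply: leq_trans ki; rewrite ltnS.
apply: leq_trans (_ : \sum_(j < k.+1) 1 <= _); last by rewrite sum1_card card_ord.
by apply: leq_sum => j _; exact: leq_b1.
Qed.

Lemma inball_dist u v : dist u v <= Rr -> inball (dist u v) u v.
Proof.
move=> dR; apply: contraT => nb.
suff : dist u v < dist u v by rewrite ltnn.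
rewrite {2}/dist; apply: (@leq_trans (\sum_(i < Rr.+1) (i < (dist u v).+1))).
  move: dR; move: (dist u v) (Rr) => d k dk.
  rewrite (eq_bigr (fun i : 'I_k.+1 => if i < d.+1 then 1 else 0)) => [|i _]; last by case: ltnP.
  rewrite -big_mkcond -(big_mkord (fun i => i < d.+1) (fun=> 1)) /=.
  by rewrite -(big_nat_widen _ _ _ xpredT) // sum_nat_const_nat subn0 muln1.
apply: leq_sum => i _; rewrite ltnS; case: (leqP i (dist u v)) => // id_.
by case e: (inball i u v) => //; rewrite (inball_mono id_ e) in nb.
Qed.

Lemma dist_edge u v w : edge v w -> dist u v <= (dist u w).+1.
Proof.
move=> vw; case: (leqP (dist u w) Rr) => [h|h]; last first.
  by rewrite (leq_trans (dist_le_cap u v)) // ltnW.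
apply: dist_le; apply/orP; right; apply/existsP; exists w.
by apply/andP; split=> //; exact: inball_dist.
Qed.

(** The shift of [u] reaches [v], for otherwise [v] itself would score at least as much. Every other
    claim arrives with a strictly smaller remaining shift, so it cannot prevail, whatever the
    IDs. *)
Lemma center_of_leader u v :
  (forall u', u' != u ->
     r u' + (Rr.+1 - dist u' v) < r u + (Rr.+1 - dist u v)) ->
  center v = id u.
Proof.
move=> lead.
have du : dist u v <= r u.
  case: (eqVneq v u) => [->|vu]; first by rewrite (leq_trans (dist_le (eqxx _ : inball 0 u u))).
  have d0 : dist v v <= 0 by apply: dist_le => /=.
  have := lead v vu; move: d0 (dist_le_cap u v) (r_le u); lia.
have duR : dist u v <= Rr by apply: leq_trans du (r_le u).
have lb := best_ge duR (inball_dist duR).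
rewrite -/(claim v) in lb.
have lbE : key u - dist u v * B = (r u - dist u v) * B + id u.
  by rewrite /key mulnBl addnBAC // leq_mul2r du orbT.
suff : claim v = (r u - dist u v) * B + id u.
  by move=> e; rewrite /center e modnMDl modn_small.
rewrite lbE in lb.
have [u' [i iR [u'v e]]] := best_witness Rr v; rewrite -/(claim v) in e.
have di := dist_le u'v.
case: (eqVneq u' u) => [uu|u'u].
  apply/eqP; rewrite eqn_leq lb andbT -lbE e uu leq_sub2l //.
  by rewrite leq_mul2r -uu di orbT.
have l := lead _ u'u.
have l1 : r u' + dist u v < r u + dist u' v.
  by move: l (dist_le_cap u' v); lia.
have h1 : claim v <= key u' - dist u' v * B by rewrite e leq_sub2l // leq_mul2r di orbT.
have h2 : key u' <= (r u - dist u v + dist u' v) * B.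
  rewrite /key; apply: (@leq_trans (r u' * B + B)); first by rewrite leq_add2l ltnW.
  by rewrite -mulSnr leq_mul2r; apply/orP; right; lia.
apply/eqP; rewrite eqn_leq lb andbT; apply: leq_trans h1 _.
by rewrite leq_subLR (leq_trans h2) // mulnDl; lia.
Qed.

(** Along an edge each distance changes by at most one, so a lead of 3 at [v] is still positive at
    [w]. *)
Lemma center_of_gap u v w : edge v w ->
  (forall u', u' != u ->
     r u' + (Rr.+1 - dist u' v) + 3 <= r u + (Rr.+1 - dist u v)) ->
  center v = center w.
Proof.
move=> vw gap; rewrite (@center_of_leader u v) => [|u' /gap]; last by lia.
rewrite (@center_of_leader u w) // => u' /gap.
have wv : edge w v by rewrite edge_sym.
move: (dist_edge u' vw) (dist_edge u' wv) (dist_edge u vw) (dist_edge u wv).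
move: (dist_le_cap u' v) (dist_le_cap u v) (dist_le_cap u w); lia.
Qed.

End Clustering.

(** * Truncated geometric variables from random bits *)

Section Shift.
Variables (R : realType) (p : R) (Rr b : nat).

(** The number of [b]-bit outcomes with shift at least [j], for [j <= Rr]. *)
Definition threshold (j : nat) : nat := Num.truncn (2 ^+ b * (1 - p) ^+ j).

(* A truncated geometric variable of parameter [p], obtained by rounding from a
   uniform number with [b] bits. *)
Definition shift (x : b.-tuple bool) : nat :=
  (\sum_(j < Rr) (enum_rank x < threshold j.+1))%N.

Lemma shift_le x : (shift x <= Rr)%N.
Proof.
apply: (@leq_trans (\sum_(j < Rr) 1)%N); last by rewrite sum1_card card_ord.
by apply: leq_sum => j _; exact: leq_b1.
Qed.

Hypothesis p01 : 0 < p <= 3^-1.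

Let q0 : 0 <= 1 - p. Proof. by case/andP: p01 => ? ?; lra. Qed.
Let q1 : 1 - p <= 1. Proof. by case/andP: p01 => ? ?; lra. Qed.

Let x0 j : 0 <= 2 ^+ b * (1 - p) ^+ j.
Proof. by rewrite mulr_ge0 ?exprn_ge0. Qed.

Lemma threshold_itv j :
  (threshold j)%:R <= 2 ^+ b * (1 - p) ^+ j < (threshold j).+1%:R.
Proof. exact: truncn_itv. Qed.

Lemma threshold_le i j : (i <= j)%N -> (threshold j <= threshold i)%N.
Proof.
move=> ij; apply: le_truncn; rewrite ler_pM2l ?exprn_gt0 //.
exact: ler_wiXn2l.
Qed.

Lemma threshold0 : threshold 0 = (2 ^ b)%N.
Proof. by rewrite /threshold expr0 mulr1 -natrX natrK. Qed.

Lemma card_rank_lt (T : finType) m : (m <= #|T|)%N ->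
  #|[set x : T | (enum_rank x < m)%N]| = m.
Proof.
have wi (mT : (m <= #|T|)%N) : injective (widen_ord mT).
  by move=> i j /(congr1 val) /= /val_inj.
move=> mT; rewrite -[RHS]card_ord -(card_imset _ (wi mT)).
rewrite -[LHS](card_imset _ (@enum_rank_inj T)); apply: eq_card => i.
apply/imsetP/imsetP => [[x]|[k _ ->]].
  by rewrite inE => xm ->; exists (Ordinal xm) => //; exact: val_inj.
by exists (enum_val (widen_ord mT k)); rewrite ?inE enum_valK //=.
Qed.

Lemma shift_geE j x : (j <= Rr)%N ->
  (j <= shift x)%N = (enum_rank x < threshold j)%N.
Proof.
case: j => [_|j jR].
  by rewrite threshold0 (leq_trans (ltn_ord _)) // card_tuple card_bool.
apply/idP/idP => [h|h].
  rewrite ltnNge; apply/negP => le.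
  suff: (shift x <= j)%N by rewrite leqNgt h.
  apply: (@leq_trans (\sum_(i < Rr) (i < j))%N).
    apply: leq_sum => i _; case: (leqP j i) => [ji|_]; last exact: leq_b1.
    by rewrite ltnNge (leq_trans _ le) // threshold_le.
  rewrite (eq_bigr (fun i : 'I_Rr => if (i < j)%N then 1%N else 0%N)) => [|i _]; last by case: ltnP.
  rewrite -big_mkcond -(big_mkord (fun i => (i < j)%N) (fun=> 1%N)) /=.
  by rewrite -(big_nat_widen _ _ _ xpredT) ?(ltnW jR) // sum_nat_const_nat subn0 muln1.
rewrite /shift; apply: (@leq_trans (\sum_(i < Rr) (i < j.+1))%N).
  rewrite (eq_bigr (fun i : 'I_Rr => if (i < j.+1)%N then 1%N else 0%N)) => [|i _]; last by case: ltnP.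
  rewrite -big_mkcond -(big_mkord (fun i => (i < j.+1)%N) (fun=> 1%N)) /=.
  by rewrite -(big_nat_widen _ _ _ xpredT) // sum_nat_const_nat subn0 muln1.
apply: leq_sum => i _; case: (ltnP i j.+1) => // ij.
by rewrite (leq_trans h) // threshold_le.
Qed.

Lemma card_shift_ge j : (j <= Rr)%N ->
  #|[set x | (j <= shift x)%N]| = threshold j.
Proof.
move=> jR; rewrite -[RHS](@card_rank_lt (b.-tuple bool)); last first.
  by rewrite card_tuple card_bool -threshold0 threshold_le.
by apply: eq_card => x; rewrite !inE shift_geE.
Qed.

(** Approximate memorylessness: three steps lose a fraction [1 - (1 - p) ^+ 3 <= 3 * p] of the tail,
    rounding costs at most 2 outcomes, and near the truncation at [Rr] the whole tail has mass at
    most [d2]. *)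
Lemma shift_tail (d2 : R) : 2 <= d2 * 2 ^+ b -> (1 - p) ^+ (Rr - 2) <= d2 ->
  forall j, #|[set x | (j <= shift x < j + 3)%N]|%:R <=
    3 * p * #|[set x | (j <= shift x)%N]|%:R + d2 * #|{: b.-tuple bool}|%:R.
Proof.
case/andP: p01 => p_gt0 p_le d2b tail j.
have N : #|{: b.-tuple bool}|%:R = 2 ^+ b :> R.
  by rewrite card_tuple card_bool natrX.
have N0 : 0 < 2 ^+ b :> R by rewrite exprn_gt0.
rewrite N; have pos : 0 <= 3 * p * #|[set x | (j <= shift x)%N]|%:R.
  by rewrite !mulr_ge0 // ltW.
case: (leqP (j + 3) Rr) => jR.
  have c : (#|[set x | (j <= shift x < j + 3)%N]| + threshold (j + 3))%N = threshold j.
    rewrite -card_shift_ge // -card_shift_ge; last by lia.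
    rewrite -cardsUI [X in (_ + X)%N](_ : _ = 0%N) ?addn0; last first.
      by apply: eq_card0 => x; rewrite !inE ltnNge; case: (j + 3 <= _)%N; rewrite ?andbF.
    apply: eq_card => x; rewrite !inE; lia.
  rewrite card_shift_ge; last by lia.
  move/(congr1 (fun k : nat => k%:R : R)): c; rewrite natrD => c.
  have /andP[_] := threshold_itv (j + 3); rewrite -(natr1 (threshold (j + 3))) exprD mulrA => h3.
  have /andP[h0 h0'] := threshold_itv j; rewrite -(natr1 (threshold j)) in h0'.
  have b3 : 1 - 3 * p <= (1 - p) ^+ 3.
    rewrite !exprS expr0 mulr1.
    have : 0 <= p * p * (3 - p) by rewrite !mulr_ge0 ?(ltW p_gt0) //; lra.
    nra.
  have h4 := ler_wpM2l (x0 j) b3.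
  have h5 : 3 * p * (2 ^+ b * (1 - p) ^+ j) <= 3 * p * ((threshold j)%:R + 1).
    by apply: ler_wpM2l; [lra|exact: ltW].
  have h6 : (3 * p <= 1) by lra.
  move: h0 h0' h3 h4 h5; move: (2 ^+ b * (1 - p) ^+ j) ((1 - p) ^+ 3) => z q h0 h0' h3 h4 h5.
  lra.
apply: le_trans (_ : d2 * 2 ^+ b <= _); last by rewrite lerDr.
case: (leqP j Rr) => [jR'|Rj]; last first.
  rewrite (_ : #|_| = 0%N); first by apply: le_trans d2b.
  apply: eq_card0 => x; rewrite !inE; have := shift_le x; lia.
apply: le_trans (_ : (threshold j)%:R <= _).
  rewrite -card_shift_ge // ler_nat subset_leq_card //.
  by apply/subsetP => x; rewrite !inE => /andP[].
have /andP[h _] := threshold_itv j; apply: (le_trans h).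
rewrite mulrC ler_pM2r //; apply: le_trans tail; apply: ler_wiXn2l => //; lia.
Qed.

End Shift.

(** * Markov's inequality and independent repetition *)

Lemma markov_half (R : realType) (T : finType) (F : T -> nat) (M : R) : 0 < M ->
  (\sum_x F x)%N%:R <= M * #|T|%:R ->
  (2 * #|[set x | (2 * M < (F x)%:R)%R]| <= #|T|)%N.
Proof.
move=> M0 h; set A := [set x | _].
rewrite -(ler_nat R) -(ler_pM2l M0) natrM mulrA; apply: le_trans h.
rewrite mulr_natr -sumr_const natr_sum big_mkcond /=; apply: ler_sum => x _.
by rewrite inE; case: ifP => // xA; rewrite [M * 2]mulrC ltW.
Qed.

Lemma card_all_bad (T : finType) (L : nat) (A : {set T}) : (2 * #|A| <= #|T|)%N ->
  (2 ^ L * #|[set f : {ffun 'I_L -> T} | [forall i, f i \in A]]| <= #|{: {ffun 'I_L -> T}}|)%N.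
Proof.
move=> h; rewrite card_ffun card_ord.
have -> : #|[set f : {ffun 'I_L -> T} | [forall i, f i \in A]]| = (#|A| ^ L)%N.
  rewrite -[in RHS](card_ord L) -card_ffun_on; apply: eq_card => f; rewrite inE.
  by apply/forallP/ffun_onP.
by rewrite -expnMn; case: L => // L; rewrite leq_exp2r.
Qed.

(** * Message-passing protocols *)

Section Protocols.
Local Open Scope nat_scope.

Definition encode (bw m : nat) : bw.-bseq bool :=
  nth [bseq] (enum {: bw.-bseq bool}) m.

Definition decode (bw : nat) (b : bw.-bseq bool) : nat :=
  index b (enum {: bw.-bseq bool}).

Lemma encodeK bw m : m < 2 ^ bw -> decode (encode bw m) = m.
Proof.
move=> mb; rewrite /decode index_uniq ?enum_uniq // -cardT.
apply: leq_trans mb _; rewrite -[2]card_bool -card_tuple.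
apply: (@leq_card _ _ (@bseq_of_tuple bw bool)) => t t' /(congr1 val) /=.
exact: val_inj.
Qed.

(* One synchronous round. Messages are natural numbers below [2 ^ bw]; a missing
   message reads as 0. *)
Record step (S : Type) := Step {
  snd_of : S -> nat -> nat;
  rcv_of : S -> (nat -> nat) -> S }.

(** The remaining schedule is part of the state and is the same at all vertices, so the current
    phase is known without communication. *)
Definition protocol (bw rb : nat) (S : Type) (ss : seq (step S))
    (init : nat -> seq nat -> rb.-tuple bool -> S) (out : S -> bool) :
    congest_program :=
  {| rounds := size ss; bandwidth := bw; random_bits := rb;
     state := seq (step S) * S;
     init := fun i nb w => (ss, init i nb w);
     send := fun st i =>
       encode bw (if st.1 is s :: _ then snd_of s st.2 i else 0);
     receive := fun st ib =>
       if st.1 is s :: ss'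
       then (ss', rcv_of s st.2 (fun i => if ib i is Some b then decode b else 0))
       else st;
     output := fun st => out st.2 |}.

Variables (G : sgraph) (id : G -> nat).
Hypothesis id_inj : injective id.
Variable S : Type.
Implicit Types (s : step S) (ss : seq (step S)) (X : G -> S).

Definition message_to s X (v : G) (i : nat) : nat :=
  if [pick u | edge v u && (id u == i)] is Some u then snd_of s (X u) (id v)
  else 0.

Definition run1 X s : G -> S :=
  fun v => rcv_of s (X v) (message_to s X v).

Definition run ss X : G -> S := foldl run1 X ss.

Lemma message_toE s X v w : edge v w ->
  message_to s X v (id w) = snd_of s (X w) (id v).
Proof.
move=> vw; rewrite /message_to; case: pickP => [u /andP[_ /eqP/id_inj->] //|].
by move/(_ w); rewrite vw eqxx.
Qed.

Variable bw : nat.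

Fixpoint fits ss X : Prop :=
  if ss is s :: ss' then
    (forall v w, edge v w -> snd_of s (X w) (id v) < 2 ^ bw) /\ fits ss' (run1 X s)
  else True.

Lemma fits_cat ss1 ss2 X :
  fits (ss1 ++ ss2) X <-> fits ss1 X /\ fits ss2 (run ss1 X).
Proof.
elim: ss1 X => [|s s1 IH] X /=; first by split=> [|[]].
by rewrite IH; tauto.
Qed.

(** A triple on global configurations that also records that all messages fit the bandwidth. *)
Definition hoare (I : (G -> S) -> Prop) ss (Q : (G -> S) -> Prop) : Prop :=
  forall X, I X -> fits ss X /\ Q (run ss X).

Lemma hoare_cat I J Q ss1 ss2 :
  hoare I ss1 J -> hoare J ss2 Q -> hoare I (ss1 ++ ss2) Q.
Proof.
move=> h1 h2 X /h1[f1 /h2[f2 q]]; split; first exact/fits_cat.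
by rewrite /run foldl_cat.
Qed.

Lemma hoare_cons I J Q s ss :
  hoare I [:: s] J -> hoare J ss Q -> hoare I (s :: ss) Q.
Proof. exact: (@hoare_cat _ _ _ [:: s]). Qed.

Lemma hoare1 I s Q :
  (forall X, I X -> (forall v w, edge v w -> snd_of s (X w) (id v) < 2 ^ bw) /\
                    Q (run1 X s)) -> hoare I [:: s] Q.
Proof. by move=> h X /h[? ?]. Qed.

Lemma hoare_iter (I : nat -> (G -> S) -> Prop) (F : nat -> step S) m :
  (forall t, t < m -> hoare (I t) [:: F t] (I t.+1)) ->
  hoare (I 0) [seq F t | t <- iota 0 m] (I m).
Proof.
elim: m => [_ X|m IH h]; first by split.
rewrite -addn1 iotaD map_cat /= add0n addn1.
by apply: hoare_cat (h m _); [apply: IH => t tm; apply: h; exact: ltnW|].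
Qed.

(** When every message fits, decoding recovers the numbers sent, so bit strings can be forgotten
    from here on. *)
Lemma protocol_run rb ss (init : nat -> seq nat -> rb.-tuple bool -> S) out
    (w : coins G (protocol bw ss init out)) v :
  fits ss (fun u => init (id u) (neighbour_ids id u) (w u)) ->
  result id w v =
  out (run ss (fun u => init (id u) (neighbour_ids id u) (w u)) v).
Proof.
set P := protocol _ _ _ _; set X0 := fun u => _.
rewrite /result.
pose stp (c : G -> state P) : G -> state P :=
  fun v => receive (c v) (inbox id c v).
have cfg t : config id w t = iter t stp (config id w 0) by elim: t => //= t ->.
suff main ss' c X : (forall u, c u = (ss', X u)) -> fits ss' X ->
    forall u, iter (size ss') stp c u = ([::], run ss' X u).
  by move=> h; rewrite cfg (main ss _ X0).
elim: ss' c X => [|s ss' IH] c X cX //= [fs fss] u.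
rewrite -iterS iterSr; apply: IH fss _ => {}u.
rewrite /stp /= cX /=; congr pair; rewrite /run1; congr rcv_of.
apply: boolp.funext => i; rewrite /inbox /message_to.
case: pickP => // w' /andP[uw' _]; rewrite /= cX /= encodeK //.
exact: fs.
Qed.

End Protocols.

(** * One trial of the algorithm *)

(** Sorting pairs of key and element shows that only keys of elements of [s] matter; local tables
    agree with the global loads only on neighbours. *)
Lemma eq_in_sort_key (T : eqType) (T' : Type) (le : rel T') (f g : T -> T')
    (s : seq T) : {in s, f =1 g} -> sort (relpre f le) s = sort (relpre g le) s.
Proof.
pose key (h : T -> T') x := (h x, x); move=> fg.
have e (h : T -> T') : sort (relpre h le) s =
    [seq p.2 | p <- sort (relpre (fun p : T' * T => p.1) le) [seq key h x | x <- s]].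
  by rewrite sort_map -map_comp /= map_id.
by rewrite !e; congr (map _ (sort _ _)); apply/eq_in_map => x /fg; rewrite /key => ->.
Qed.

Lemma eq_in_find (T : eqType) (a1 a2 : pred T) (s : seq T) :
  {in s, a1 =1 a2} -> find a1 s = find a2 s.
Proof.
move=> e; have f (a : pred T) : find a s = find id [seq a x | x <- s].
  by rewrite find_map.
by rewrite !f; congr find; apply/eq_in_map.
Qed.

Section NeighbourLists.
Local Open Scope nat_scope.
Variables (G : sgraph) (id : G -> nat).

Definition neighbours (v : G) : seq G := sort (relpre id leq) (enum (edge v)).

Lemma neighbour_idsE v : neighbour_ids id v = [seq id w | w <- neighbours v].
Proof. exact: sort_map. Qed.

Lemma mem_neighbours v w : (w \in neighbours v) = edge v w.
Proof. by rewrite mem_sort mem_enum. Qed.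

Lemma neighbours_uniq v : uniq (neighbours v).
Proof. by rewrite sort_uniq enum_uniq. Qed.

Lemma big_neighbours (T : Type) (x : T) (op : Monoid.com_law x) v (F : G -> T) :
  \big[op/x]_(w <- neighbours v) F w = \big[op/x]_(w | edge v w) F w.
Proof.
by rewrite (perm_big (enum (edge v))) ?perm_sort // big_enum.
Qed.

End NeighbourLists.

(** * The local program of a trial *)

Section Program.
Variables (R : realType) (K : R) (B Rr T P W : nat).
Variables (tm : nat -> nat) (lev : nat -> R).

(* [lrep] holds the last claims heard from the neighbours, [lcov t] the loads of
   the incident edges after [t] covering rounds, [lres] the convergecast totals,
   [ldec] the broadcast decision; all are indexed by neighbour IDs. *)
Record lstate := LState {
  lid : nat; lnb : seq nat; ltape : nat -> nat; lmark : bool; lclaim : nat;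
  lrep : nat -> nat; lcov : nat -> nat -> R; lres : nat -> nat; ldec : nat }.

(* What a vertex of capacity [K] gives to its [i]-th least loaded edge. *)
Definition share (i : nat) : R := Num.max 0 (Num.min 1 (K - i%:R)).

Definition live_neighbours (s : lstate) : seq nat :=
  [seq i <- lnb s | [&& ((lrep s i)./2 %% B == lclaim s %% B)%N,
                        ~~ lmark s & ~~ odd (lrep s i)]].

Definition order_of (s : lstate) (t : nat) : seq nat :=
  sort (relpre (lcov s t) (fun x y => x <= y)) (live_neighbours s).

Definition local_degree (s : lstate) (q : nat) : nat :=
  count (fun i => lcov s (tm q) i <= lev q) (live_neighbours s).

(* Three counts packed in base [W]: members, degrees of members, degrees of
   non-members. *)
Definition pack (d : nat) : nat :=
  if K < d%:R then (1 + W * d)%N else (W * W * d)%N.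

Definition dense_pack (x : nat) : bool :=
  2 * K * (x %% W)%:R < (x %/ W %% W)%:R - (x %/ W %/ W)%:R.

Definition local_root (s : lstate) : bool := (lclaim s %% B == lid s)%N.

Definition local_parent (s : lstate) : nat :=
  nth 0%N (lnb s) (find (fun i => (lrep s i)./2 == lclaim s + B)%N (lnb s)).

Definition start_step (i : nat) : step lstate :=
  Step (fun _ _ => 0%N)
    (fun s _ => LState (lid s) (lnb s) (ltape s) (lmark s)
       (ltape s i * B + lid s) (lrep s) (fun _ _ => 0) (lres s) (ldec s)).

Definition claim_step : step lstate :=
  Step (fun s _ => (lmark s + (lclaim s).*2)%N)
    (fun s ib => LState (lid s) (lnb s) (ltape s) (lmark s)
       (maxn (lclaim s) (\max_(i <- lnb s) ((ib i)./2 - B)))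
       ib (lcov s) (lres s) (ldec s)).

(** Loads are real numbers and are never sent: the rank of the edge in the order of the sender
    determines its [share], so both ends compute the new load exactly. *)
Definition cover_step (t : nat) : step lstate :=
  Step (fun s i => index i (order_of s t))
    (fun s ib => LState (lid s) (lnb s) (ltape s) (lmark s) (lclaim s) (lrep s)
       (fun t' => if t' == t.+1
          then fun i => lcov s t i + (share (index i (order_of s t)) + share (ib i))
          else lcov s t')
       (lres s) (ldec s)).

(* A vertex of height [h] completes item [q] in round [h + q] and reports it to
   its parent, of height [h + 1], in the next round. *)
Definition up_step (r : nat) : step lstate :=
  Step (fun s i =>
      let h := (lclaim s %/ B)%N in
      if [&& ~~ local_root s, i == local_parent s, (h < r)%N & (r - h.+1 < P)%N]
      then lres s (r - h.+1)%N else 0%N)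
    (fun s ib =>
      let h := (lclaim s %/ B)%N in
      LState (lid s) (lnb s) (ltape s) (lmark s) (lclaim s) (lrep s) (lcov s)
       (fun q => if (h + q == r)%N
          then (pack (local_degree s q) + \sum_(i <- lnb s) ib i)%N else lres s q)
       (ldec s)).

(** The index [P], returned by [find] on failure, means that the cluster has no dense item. *)
Definition down_step : step lstate :=
  Step (fun s _ => ldec s)
    (fun s ib =>
      LState (lid s) (lnb s) (ltape s) (lmark s) (lclaim s) (lrep s) (lcov s)
       (lres s)
       (if local_root s then find (fun q => dense_pack (lres s q)) (iota 0 P)
        else ib (local_parent s))).

Definition finish_step : step lstate :=
  Step (fun _ _ => 0%N)
    (fun s _ =>
      LState (lid s) (lnb s) (ltape s)
       (lmark s || ((ldec s < P)%N && (K < (local_degree s (ldec s))%:R)))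
       (lclaim s) (lrep s) (lcov s) (lres s) (ldec s)).

(** [Rr] rounds settle the claims; one more lets every vertex hear the settled claims of its
    neighbours. *)
Definition trial (i : nat) : seq (step lstate) :=
  start_step i :: map (fun=> claim_step) (iota 0 Rr.+1) ++ map cover_step (iota 0 T) ++
  map up_step (iota 0 (P + Rr)%N) ++ map (fun=> down_step) (iota 0 Rr.+1) ++
  [:: finish_step].

Lemma size_trial i : size (trial i) = (2 * Rr.+1 + T + (P + Rr) + 2)%N.
Proof.
rewrite /trial /= !(size_cat, size_map, size_iota) /=.
by rewrite !(size_cat, size_map, size_iota) /=; lia.
Qed.

(** * Global description of the data computed in a trial *)

Section TrialSemantics.
Variables (G : sgraph) (id : G -> nat).
Hypothesis id_inj : injective id.
Hypothesis id_lt : forall v, (id v < B)%N.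
Variables (r : G -> nat) (marked : {set G}).
Hypothesis r_le : forall v, (r v <= Rr)%N.

Local Notation claim := (claim id B Rr r).
Local Notation center := (center id B Rr r).
Local Notation height := (height id B Rr r).
Local Notation is_root := (is_root id B Rr r).

Definition live (v w : G) : bool :=
  [&& edge v w, center v == center w, v \notin marked & w \notin marked].

Definition ordering (c : G -> G -> R) (v : G) : seq G :=
  sort (relpre (c v) (fun x y => x <= y)) [seq w <- neighbours id v | live v w].

Fixpoint load (t : nat) : G -> G -> R :=
  if t is t'.+1 then fun v w =>
    load t' v w + (share (index w (ordering (load t') v)) +
                   share (index v (ordering (load t') w)))
  else fun _ _ => 0.

Definition give t v w : R := share (index w (ordering (load t) v)).

Definition level_graph (q : nat) : rel G := level live load (tm q) (lev q).

Definition own (q : nat) (v : G) : nat := pack (degree (level_graph q) v).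

Definition parent (v : G) : G :=
  nth v (neighbours id v) (find (fun w => claim w == claim v + B)%N (neighbours id v)).

Definition child (w v : G) : bool := ~~ is_root w && (parent w == v).

Fixpoint subtotal (h q : nat) (v : G) : nat :=
  (own q v + if h is h'.+1 then \sum_(w | child w v) subtotal h' q w else 0)%N.

Definition total (q : nat) (v : G) : nat := subtotal (height v) q v.

Definition decision (v : G) : nat :=
  find (fun q => dense_pack (\sum_(u | center u == center v) own q u)) (iota 0 P).

Definition next_marked : {set G} :=
  marked :|: [set v | (decision v < P)%N &&
                      (K < (degree (level_graph (decision v)) v)%:R)].

Lemma parentP v : ~~ is_root v -> edge v (parent v) /\ claim (parent v) = (claim v + B)%N.
Proof.
move=> nr; have [w vw cw] := claim_parent id_lt r_le nr.
have hp : has (fun w => claim w == claim v + B)%N (neighbours id v).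
  by apply/hasP; exists w; rewrite ?mem_neighbours ?cw.
split; last exact/eqP/(nth_find v hp).
by rewrite -(mem_neighbours id) mem_nth // -has_find.
Qed.

Lemma childP w v : child w v ->
  [/\ edge v w, center w = center v & height v = (height w).+1].
Proof.
case/andP => nr /eqP e; have [ev cv] := parentP nr; rewrite e in ev cv.
by rewrite edge_sym ev -(parent_center cv) (parent_height id_lt cv).
Qed.

Lemma totalE q v : total q v = (own q v + \sum_(w | child w v) total q w)%N.
Proof.
rewrite /total; case e: (height v) => [|h] /=; congr addn.
  by rewrite big_pred0 // => w; apply/negP => /childP[_ _]; rewrite e.
by apply: eq_bigr => w /childP[_ _]; rewrite e => -[->].
Qed.

(** Summing [totalE] over the cluster counts each non-root once as a child. Cancelling these totals
    leaves that of the only root. *)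
Lemma total_root q rt : is_root rt ->
  total q rt = (\sum_(u | center u == center rt) own q u)%N.
Proof.
move=> rr; pose C u := center u == center rt.
apply/eqP; rewrite -(eqn_add2r (\sum_(u | C u && ~~ is_root u) total q u)%N).
have -> : (total q rt + \sum_(u | C u && ~~ is_root u) total q u =
    \sum_(u | C u) total q u)%N.
  rewrite [RHS](bigID is_root) /= [X in _ = (X + _)%N](big_pred1 rt) // => u /=.
  apply/andP/eqP => [[/eqP cu ru]|->]; last by rewrite /C eqxx.
  exact: (root_uniq id_inj ru rr).
rewrite [eqbLHS](_ : _ = \sum_(u | C u) own q u + \sum_(u | C u) \sum_(w | child w u) total q w)%N.
  rewrite eqn_add2l; apply/eqP.
  rewrite (exchange_big_dep (fun w => C w && ~~ is_root w)) /=; last first.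
    by move=> u w cu cw; have [_ e _] := childP cw; case/andP: cw => -> _; rewrite andbT /C e.
  apply: eq_bigr => w /andP[cw nw]; rewrite (big_pred1 (parent w)) // => u /=.
  rewrite /child nw /= [RHS]eq_sym; case: eqP => [<-|]; rewrite ?andbF // andbT.
  by have [_ /parent_center] := parentP nw; rewrite /C => ->.
by rewrite -big_split /=; apply: eq_bigr => u _; rewrite totalE.
Qed.

(** Totals grow towards the root, where they range over a single cluster. This bounds the
    convergecast messages. *)
Lemma total_le q v : (total q v <= \sum_u own q u)%N.
Proof.
have [m] := ubnP (Rr - height v); elim: m v => // m IH v hm.
case: (boolP (is_root v)) => [rv|nr].
  by rewrite total_root // [leqRHS](bigID (fun u => center u == center v)) leq_addr.
have [ev cv] := parentP nr; have hh := parent_height id_lt cv.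
apply: leq_trans (IH (parent v) _); last first.
  by move: hm (height_le id_lt r_le (parent v)); lia.
rewrite [leqRHS]totalE (bigD1 v) //=; last by rewrite /child nr eqxx.
by rewrite addnCA leq_addr.
Qed.


(** * Invariants of the phases of a trial *)

Section TrialRun.
Variables (bw i : nat) (tape : G -> nat -> nat).
Hypothesis tapeE : forall v, tape v i = r v.
Hypothesis tm_le : forall q, (q < P)%N -> (tm q <= T)%N.
Hypothesis bw_claim : ((Rr.+1 * B).*2 < 2 ^ bw)%N.
Hypothesis bw_card : (#|G| < 2 ^ bw)%N.
Hypothesis bw_item : (P < 2 ^ bw)%N.
Hypothesis bw_total :
  (#|G| * (W * W * #|G| + W * #|G| + 1) < 2 ^ bw)%N.

Implicit Type X : G -> lstate.

Definition fixed_part (S : {set G}) X : Prop := forall v,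
  [/\ lid (X v) = id v, lnb (X v) = neighbour_ids id v, ltape (X v) = tape v,
      lmark (X v) = (v \in S) & (ldec (X v) <= P)%N].

Definition no_load X : Prop := forall v w, lcov (X v) 0 (id w) = 0.

Definition claiming t X : Prop :=
  [/\ fixed_part marked X, no_load X, (forall v, lclaim (X v) = best id B r t v) &
      (0 < t)%N -> forall v w, edge v w ->
        lrep (X v) (id w) = ((w \in marked) + (best id B r t.-1 w).*2)%N].

Definition claimed X : Prop :=
  [/\ fixed_part marked X, (forall v, lclaim (X v) = claim v) &
      forall v w, edge v w ->
        lrep (X v) (id w) = ((w \in marked) + (claim w).*2)%N].

Definition covering t X : Prop := claimed X /\
  forall t', (t' <= t)%N -> forall v w, edge v w ->
    lcov (X v) t' (id w) = load t' v w.

Definition collecting m X : Prop := covering T X /\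
  forall v q, (q < P)%N -> (height v + q < m)%N -> lres (X v) q = total q v.

(** Roots have height at most [Rr], so a vertex of height [h] knows the decision after [Rr - h + 1]
    rounds. *)
Definition deciding m X : Prop := collecting (P + Rr) X /\
  forall v, (Rr - height v < m)%N -> ldec (X v) = decision v.

Lemma two_pow_gt0 : (0 < 2 ^ bw)%N. Proof. by rewrite expn_gt0. Qed.

Lemma hoare_start : hoare id bw (fixed_part marked) [:: start_step i] (claiming 0).
Proof.
apply: hoare1 => X fX; split=> [v w _|]; first exact: two_pow_gt0.
split=> //= v; by have [-> _ -> _ _] := fX v; rewrite tapeE.
Qed.

Lemma sum_message st X v (F : G -> nat) :
  (forall w, edge v w -> snd_of st (X w) (id v) = F w) ->
  (\sum_(j <- neighbour_ids id v) message_to id st X v j)%N = (\sum_(w | edge v w) F w)%N.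
Proof.
move=> h; rewrite neighbour_idsE big_map big_neighbours; apply: eq_bigr => w vw.
by rewrite message_toE // h.
Qed.

Lemma hoare_claim t : hoare id bw (claiming t) [:: claim_step] (claiming t.+1).
Proof.
apply: hoare1 => X [fX nX cX _]; split=> [v w _ /=|].
  have [_ _ _ -> _] := fX w; rewrite cX.
  apply: leq_ltn_trans bw_claim; have : (best id B r t w < Rr.+1 * B)%N.
    have [u [k _ [_ ->]]] := best_witness id B r t w.
    by apply: leq_ltn_trans (key_lt id_lt r_le u); exact: leq_subr.
  by rewrite -!muln2; case: (w \in marked); lia.
have msg v w : edge v w -> message_to id claim_step X v (id w) =
     ((w \in marked) + (best id B r t w).*2)%N.
  by move=> vw; rewrite message_toE //= cX; have [_ _ _ -> _] := fX w.
split=> //= v.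
rewrite cX; congr maxn; have [_ -> _ _ _] := fX v.
rewrite neighbour_idsE big_map big_neighbours; apply: eq_bigr => w vw.
by rewrite msg // half_bit_double.
Qed.

Lemma claiming_done X : claiming Rr.+1 X -> covering 0 X.
Proof.
case=> fX nX cX rX; split; last first.
  by move=> t'; rewrite leqn0 => /eqP-> v w _; rewrite nX.
split=> // [v|v w vw]; first by rewrite cX best_stable.
by rewrite rX.
Qed.

Lemma live_neighboursE X v : claimed X ->
  live_neighbours (X v) = [seq id w | w <- [seq w <- neighbours id v | live v w]].
Proof.
case=> fX cX rX; rewrite /live_neighbours; have [_ -> _ -> _] := fX v.
rewrite neighbour_idsE filter_map; congr map; apply: eq_in_filter => w.
rewrite mem_neighbours => vw; rewrite /= rX // half_bit_double cX.
by rewrite oddD odd_double addbF oddb /live vw /= [RHS]andbA eq_sym andbA.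
Qed.

Lemma order_ofE t t' X v : (t' <= t)%N -> covering t X ->
  order_of (X v) t' = [seq id w | w <- ordering (load t') v].
Proof.
move=> tt [cX lX]; rewrite /order_of live_neighboursE // sort_map; congr map.
rewrite /ordering; apply: (@eq_in_sort_key _ _ _ (fun w => lcov (X v) t' (id w))) => w.
by rewrite mem_filter mem_neighbours => /andP[_ vw]; exact: lX.
Qed.

Lemma local_degreeE q X v : (q < P)%N -> covering T X ->
  local_degree (X v) q = degree (level_graph q) v.
Proof.
move=> qP [cX lX]; rewrite /local_degree live_neighboursE // count_map count_filter.
rewrite /degree -sum1_count big_mkcond /= big_neighbours big_mkcond /=.
apply: eq_bigr => w _; rewrite /level_graph /level /live.
case vw : (edge v w) => //=; rewrite lX ?tm_le // andbC.
by case: (_ && _).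
Qed.

Lemma local_rootE X v : claimed X -> local_root (X v) = is_root v.
Proof. by case=> fX cX _; rewrite /local_root cX; have [-> _ _ _ _] := fX v. Qed.

Lemma local_parentE X v : claimed X -> ~~ is_root v ->
  local_parent (X v) = id (parent v).
Proof.
case=> fX cX rX nr; rewrite /local_parent; have [_ -> _ _ _] := fX v.
rewrite neighbour_idsE find_map.
have -> : find (preim id (fun j => (lrep (X v) j)./2 == (lclaim (X v) + B)%N))
     (neighbours id v) = find (fun w => claim w == claim v + B)%N (neighbours id v).
  by apply: eq_in_find => w; rewrite mem_neighbours => vw /=; rewrite rX // half_bit_double cX.
rewrite (nth_map v) // -has_find.
have [w vw cw] := claim_parent id_lt r_le nr.
by apply/hasP; exists w; rewrite ?mem_neighbours ?cw.
Qed.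

Lemma hoare_cover t : (t < T)%N ->
  hoare id bw (covering t) [:: cover_step t] (covering t.+1).
Proof.
move=> tT; apply: hoare1 => X cov; have [cX lX] := cov.
split=> [v w vw /=|].
  rewrite (order_ofE _ (leqnn t)) // index_map //.
  apply: leq_ltn_trans bw_card; apply: leq_trans (index_size _ _) _.
  rewrite size_sort size_filter; apply: leq_trans (count_size _ _) _.
  by rewrite size_sort -cardE max_card.
split; first by case: cX => fX clX rX; split.
move=> t'; rewrite leq_eqVlt ltnS => /orP[/eqP->|tt] v w vw /=; last first.
  by rewrite ltn_eqF ?ltnS // lX.
rewrite eqxx lX // message_toE //= !(order_ofE _ (leqnn t)) // !index_map //.
Qed.

Lemma own_le q v : (own q v <= W * W * #|G| + W * #|G| + 1)%N.
Proof.
have d : (degree (level_graph q) v <= #|G|)%N.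
  rewrite /degree -sum1_card; apply: leq_sum => w _; exact: leq_b1.
rewrite /own /pack; case: ifP => _; last first.
  by rewrite -addnA (leq_trans _ (leq_addr _ _)) // leq_mul2l d orbT.
by rewrite addnC leq_add2r (leq_trans _ (leq_addl _ _)) // leq_mul2l d orbT.
Qed.

Lemma total_lt q v : (total q v < 2 ^ bw)%N.
Proof.
apply: leq_ltn_trans bw_total; apply: leq_trans (total_le q v) _.
rewrite -sum_nat_const; apply: leq_sum => u _; exact: own_le.
Qed.

Lemma hoare_up m : hoare id bw (collecting m) [:: up_step m] (collecting m.+1).
Proof.
apply: hoare1 => X [cov rX]; have [cX _] := cov; have [fX clX _] := cX.
have hX v : (lclaim (X v) %/ B)%N = height v by rewrite clX.
split=> [v w vw /=|].
  rewrite hX; case: ifP => [/and4P[_ _ hm mP]|_]; last exact: two_pow_gt0.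
  by rewrite rX //; [exact: total_lt|lia].
split; first by case: cov => [[? ? ?] ?]; split.
move=> v q qP; rewrite ltnS => hq /=; rewrite hX.
case: eqP => [e|ne]; last by apply: rX => //; lia.
rewrite local_degreeE // totalE; congr addn.
have [_ -> _ _ _] := fX v.
(* Only children contribute, and a child, of height one less, is reporting exactly item [q] in this
   round. *)
rewrite (@sum_message _ _ _ (fun w => if child w v then total q w else 0%N)).
  rewrite -big_mkcondr /=; apply: eq_bigl => w.
  by case: (boolP (child w v)) => [/childP[-> _ _]|]; rewrite ?andbF.
move=> w vw /=; rewrite hX local_rootE //.
case: (boolP (is_root w)) => [rw|nw] /=.
  by rewrite /child rw.
rewrite local_parentE // (inj_eq id_inj) /child nw /= eq_sym.
case: eqP => //= pw; have cw : child w v by rewrite /child nw pw eqxx.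
have [_ _ hv] := childP cw.
have -> : (height w < m)%N by lia.
have -> : (m - (height w).+1 = q)%N by lia.
by rewrite qP rX //; lia.
Qed.

Lemma hoare_down m : hoare id bw (deciding m) [:: down_step] (deciding m.+1).
Proof.
apply: hoare1 => X [[cov rX] dX]; have [cX _] := cov; have [fX clX rpX] := cX.
split=> [v w vw /=|].
  by have [_ _ _ _ dP] := fX w; exact: leq_ltn_trans bw_item.
have root_dec v : is_root v ->
    find (fun q => dense_pack (lres (X v) q)) (iota 0 P) = decision v.
  move=> rv; apply: eq_in_find => q; rewrite mem_iota add0n => qP.
  rewrite rX //; first by rewrite total_root.
  by have := height_le id_lt r_le v; lia.
split.
  split=> //; split; last by case: cov.
  split=> // v; have [? ? ? ? dP] := fX v; split=> //=.
  case: ifP => [_|nr]; first by rewrite (leq_trans (find_size _ _)) // size_iota.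
  rewrite local_rootE // in nr; rewrite local_parentE ?nr //.
  have [ev _] := parentP (negbT nr); rewrite message_toE //=.
  by have [] := fX (parent v).
move=> v hv /=; rewrite local_rootE //; case: ifP => [rv|/negbT nr].
  exact: root_dec.
have [ev cv] := parentP nr; rewrite local_parentE // message_toE //= dX.
  by rewrite /decision (parent_center cv).
have := parent_height id_lt cv; have := height_le id_lt r_le (parent v).
move: hv; lia.
Qed.

Lemma hoare_finish :
  hoare id bw (deciding Rr.+1) [:: finish_step] (fixed_part next_marked).
Proof.
apply: hoare1 => X [[cov rX] dX]; have [[fX _ _] _] := cov.
split=> [v w _|v /=]; first exact: two_pow_gt0.
have [? ? ? mv dP] := fX v; split=> //=.
have dv : ldec (X v) = decision v by apply: dX; lia.
rewrite mv dv !inE; congr orb; case: (ltnP (decision v) P) => //= lt.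
by rewrite local_degreeE.
Qed.

Lemma hoare_trial :
  hoare id bw (fixed_part marked) (trial i) (fixed_part next_marked).
Proof.
apply: hoare_cons hoare_start _.
apply: (hoare_cat (J := covering 0)).
  move=> X /(hoare_iter (fun t _ => hoare_claim (t := t)) (m := Rr.+1))[f /claiming_done].
  by split.
apply: (hoare_cat (J := covering T)); first exact: hoare_iter hoare_cover.
apply: (hoare_cat (J := collecting (P + Rr))).
  move=> X cX; have I0 : collecting 0 X by [].
  exact: (hoare_iter (fun t _ => hoare_up (m := t)) I0).
apply: hoare_cat hoare_finish.
move=> X cX; have I0 : deciding 0 X by [].
exact: (hoare_iter (fun t _ => hoare_down (m := t)) (m := Rr.+1) I0).
Qed.

End TrialRun.
End TrialSemantics.
End Program.

(** * Outcome of a trial *)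

Section Shares.
Variables (R : realType) (K : R).
Hypothesis K_ge0 : 0 <= K.

Lemma share_bounds i : 0 <= share K i <= 1.
Proof.
rewrite /share le_max lexx ge_max ler01 /= ge_min lexx; exact: isT.
Qed.

Lemma sum_share m : \sum_(0 <= i < m) share K i = Num.min K m%:R.
Proof.
elim: m => [|m IH].
  by rewrite big_geq //; apply/esym/min_idPr.
rewrite big_nat_recr //= IH /share -natr1.
case: (leP K m%:R) => h1; case: (leP 1 (K - m%:R)) => h2;
  case: (leP 0 _) => h3; case: (leP K _) => h4; lra.
Qed.

Lemma sum_share_index (T : eqType) (s : seq T) : uniq s ->
  \sum_(w <- s) share K (index w s) = Num.min K (size s)%:R.
Proof.
case: s => [|x0 s0]; first by rewrite big_nil; move=> _; apply/esym/min_idPr.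
move: (x0 :: s0) => s us; rewrite (big_nth x0) -sum_share.
by rewrite !big_nat; apply: eq_bigr => i /andP[_ i_lt]; rewrite index_uniq.
Qed.

(** In a sorted list the elements of key at most [th] form a prefix, and [sum_share] evaluates the
    shares of a prefix. *)
Lemma sum_share_prefix (T : eqType) (g : T -> R) (s : seq T) (th : R) :
  uniq s -> sorted (relpre g (fun x y => x <= y)) s ->
  Num.min K (count (fun w => g w <= th) s)%:R <=
  \sum_(w <- s | g w <= th) share K (index w s).
Proof.
case: s => [|x0 s0]; first by rewrite big_nil ge_min lexx orbT.
move: (x0 :: s0) => s us ss; set d := count _ s.
have tr : transitive (relpre g (fun x y : R => x <= y)).
  by move=> y x z; exact: le_trans.
have ds : (d <= size s)%N by exact: count_size.
rewrite -sum_share (big_nth x0) [leRHS](big_cat_nat (n := d)) //=.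
rewrite -[leLHS]addr0; apply: lerD; last first.
  by apply: sumr_ge0 => i _; have /andP[] := share_bounds (index (nth x0 s i) s).
rewrite [leRHS]big_mkcond /= !big_nat; apply: ler_sum => i /andP[_ id_].
rewrite index_uniq ?(leq_trans id_) //; case: (leP (g (nth x0 s i)) th) => // gt.
suff : (d <= i)%N by rewrite leqNgt id_.
rewrite /d -(cat_take_drop i s) count_cat -[leqRHS]addn0 leq_add //.
  by apply: leq_trans (count_size _ _) _; rewrite size_take; case: ltnP.
rewrite leqn0 -[_ == _]negbK -lt0n -has_count; apply/hasPn => w.
have is_ : (i < size s)%N by exact: leq_trans ds.
move: ss; rewrite -{1}(cat_take_drop i s) => /(subseq_sorted tr (suffix_subseq _ _)).
rewrite (drop_nth x0) // => sd; rewrite inE => /orP[/eqP->|ws]; first by rewrite -ltNge.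
rewrite -ltNge; apply: lt_le_trans gt _.
by have := order_path_min tr sd => /allP/(_ _ ws).
Qed.

End Shares.

Lemma edges_within_setU (G : finType) (E1 E2 E : rel G) (A U : {set G}) :
  [disjoint A & U] -> subrel E1 E -> subrel E2 E ->
  (edges_within E1 A + edges_within E2 U <= edges_within E (A :|: U))%N.
Proof.
move=> dAU s1 s2; rewrite /edges_within.
rewrite [leqRHS](eq_bigl [predU A & U]) => [|v]; last by rewrite !inE.
have sub_le (E' : rel G) (C : {set G}) v : C \subset A :|: U -> subrel E' E ->
    (\sum_(w in C) E' v w <= \sum_(w in A :|: U) E v w)%N.
  move=> /subsetP sC sE; rewrite big_mkcond [leqRHS]big_mkcond /=.
  apply: leq_sum => w _; case: ifP => // /sC ->.
  by case e : (E' v w) => //; rewrite (sE _ _ e).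
rewrite bigU //=; apply: leq_add; apply: leq_sum => v _; apply: sub_le => //.
- exact: subsetUl.
- exact: subsetUr.
Qed.

(** * From cluster decisions to the density of the marked set *)

Section TrialAnalysis.
Variables (R : realType) (K : R) (B Rr P W : nat).
Variables (tm : nat -> nat) (lev : nat -> R).
Variables (G : sgraph) (id : G -> nat) (r : G -> nat) (marked : {set G}).
Hypothesis K_ge0 : 0 <= K.
Hypothesis W_large : (#|G| ^ 2 < W)%N.

Local Notation center := (center id B Rr r).
Local Notation live := (live B Rr id r marked).
Local Notation load := (load K B Rr id r marked).
Local Notation gives := (give K B Rr id r marked).
Local Notation ordering := (@ordering R B Rr G id r marked).
Local Notation level_graph := (level_graph K B Rr tm lev id r marked).
Local Notation decision := (decision K B Rr P W tm lev id r marked).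
Local Notation next_marked := (next_marked K B Rr P W tm lev id r marked).
Local Notation own := (own K B Rr W tm lev id r marked).

Lemma live_sym : symmetric live.
Proof.
by move=> v w; rewrite /live edge_sym [center v == _]eq_sym [(v \notin _) && _]andbC.
Qed.

Lemma ordering_uniq c v : uniq (ordering c v).
Proof. by rewrite sort_uniq filter_uniq // neighbours_uniq. Qed.

Lemma mem_ordering c v w : (w \in ordering c v) = live v w.
Proof.
rewrite mem_sort mem_filter mem_neighbours /live.
by case: (edge v w); rewrite ?andbF // andbT.
Qed.

Lemma big_ordering (T : Type) (x : T) (op : Monoid.com_law x) c v (Q : pred G)
    (F : G -> T) :
  \big[op/x]_(w <- ordering c v | Q w) F w = \big[op/x]_(w | live v w && Q w) F w.
Proof.
rewrite big_mkcond [RHS]big_mkcondr -big_enum; apply: perm_big.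
apply: uniq_perm; rewrite ?ordering_uniq ?enum_uniq // => w.
by rewrite mem_ordering mem_enum.
Qed.

Lemma give_cap t v : \sum_(w | live v w) gives t v w <= K.
Proof.
have -> : \sum_(w | live v w) gives t v w =
   \sum_(w <- ordering (load t) v) gives t v w.
  by rewrite big_ordering; apply: eq_bigl => w; rewrite andbT.
rewrite /give sum_share_index ?ordering_uniq // ge_min lexx; exact: isT.
Qed.

Lemma give_greedy t v th :
  Num.min K (degree (level live load t th) v)%:R <=
  \sum_(w | level live load t th v w) gives t v w.
Proof.
have -> : degree (level live load t th) v =
    count (fun w => load t v w <= th) (ordering (load t) v).
  rewrite -sum1_count big_ordering /degree /level [RHS]big_mkcond /=.
  by apply: eq_bigr => w _; case: (_ && _).
rewrite -(big_ordering _ (load t) v (fun w => load t v w <= th) (gives t v)).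
apply: sum_share_prefix => //; first exact: ordering_uniq.
by apply: sort_sorted => x y; exact: le_total.
Qed.

(** The contribution of a vertex of degree [d] to the excess in [dense_level]; unlike the density,
    it adds up over clusters. *)
Definition gain (d : nat) : R := if K < d%:R then d%:R - 2 * K else - d%:R.

Lemma sum_gain (d : G -> nat) (C : pred G) :
  \sum_(v | C v) gain (d v) =
  (\sum_(v | C v && (K < (d v)%:R)) d v)%:R -
  (\sum_(v | C v && ~~ (K < (d v)%:R)) d v)%:R -
  2 * K * #|[set v | C v & K < (d v)%:R]|%:R.
Proof.
rewrite (bigID (fun v => K < (d v)%:R)) /= !natr_sum.
rewrite (eq_bigr (fun v => (d v)%:R - 2 * K)); last first.
  by move=> v /andP[_ h]; rewrite /gain h.
rewrite [X in _ + X](eq_bigr (fun v => - (d v)%:R)); last first.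
  by move=> v /andP[_ /negbTE h]; rewrite /gain h.
rewrite sumrN sumrB sumr_const -[in X in X + _]mulr_natr.
rewrite (_ : #|[pred v | _]| = #|[set v | C v & K < (d v)%:R]|); first ring.
by apply: eq_card => v; rewrite !inE.
Qed.

Lemma degree_le (E : rel G) v : (degree E v <= #|G|)%N.
Proof. by rewrite /degree -sum1_card; apply: leq_sum => w _; exact: leq_b1. Qed.

(** Since [W] exceeds the squared number of vertices, the two lower digits of the packed sum produce
    no carry. *)
Lemma dense_packE (d : G -> nat) (C : pred G) : (forall v, (d v <= #|G|)%N) ->
  dense_pack K W (\sum_(v | C v) pack K W (d v)) = (0 < \sum_(v | C v) gain (d v)).
Proof.
move=> dle.
set u := #|[set v | C v & K < (d v)%:R]|.
set A := (\sum_(v | C v && (K < (d v)%:R)%R) d v)%N.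
set D := (\sum_(v | C v && ~~ (K < (d v)%:R)%R) d v)%N.
have e : (\sum_(v | C v) pack K W (d v) = (D * W + A) * W + u)%N.
  rewrite (bigID (fun v => K < (d v)%:R)) /=.
  rewrite (eq_bigr (fun v => 1 + W * d v)%N); last first.
    by move=> v /andP[_ h]; rewrite /pack h.
  rewrite [X in (_ + X)%N](eq_bigr (fun v => W * W * d v)%N); last first.
    by move=> v /andP[_ /negbTE h]; rewrite /pack h.
  rewrite big_split /= sum1_card -!big_distrr /= -/A -/D.
  rewrite (_ : #|[pred v | _]| = u); last by apply: eq_card => v; rewrite !inE.
  ring.
have n1 : (#|G| <= #|G| ^ 2)%N.
  by case: #|G| => // n; rewrite -mulnn leq_pmull.
have uW : (u < W)%N by apply: leq_ltn_trans W_large; apply: leq_trans n1; exact: max_card.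
have AW : (A < W)%N.
  apply: leq_ltn_trans W_large; rewrite -mulnn -sum_nat_const /A big_mkcond /=.
  by apply: leq_sum => v _; case: ifP => // _; exact: dle.
have W0 : (0 < W)%N by apply: leq_ltn_trans uW.
rewrite /dense_pack e modnMDl modn_small // divnMDl // divn_small // addn0.
rewrite modnMDl modn_small // divnMDl // divn_small // addn0.
by rewrite sum_gain -/A -/D -/u subr_gt0.
Qed.

Lemma sum_by_center (F : G -> R) (id_lt : forall v, (id v < B)%N) :
  (forall v, \sum_(u | center u == center v) F u <= 0) ->
  \sum_v F v <= 0.
Proof.
move=> h; pose c v := Ordinal (center_lt Rr r id_lt v).
rewrite (partition_big c predT) //=; apply: sumr_le0 => j _.
case: (pickP (fun v => c v == j)) => [v /eqP <-|none]; last by rewrite big_pred0.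
exact: h.
Qed.

Hypothesis id_lt : forall v, (id v < B)%N.

Let center_gain q v : dense_pack K W (\sum_(u | center u == center v) own q u)%N =
  (0 < \sum_(u | center u == center v) gain (degree (level_graph q) u)).
Proof. by rewrite dense_packE // => u; exact: degree_le. Qed.

Lemma decision_gain v : (decision v < P)%N ->
  0 < \sum_(u | center u == center v) gain (degree (level_graph (decision v)) u).
Proof.
move=> dP; rewrite -center_gain.
have hp : has (fun q => dense_pack K W (\sum_(u | center u == center v) own q u)%N) (iota 0 P).
  by rewrite has_find size_iota.
by have := nth_find 0%N hp; rewrite -/(decision v) nth_iota // add0n.
Qed.

Lemma no_decision_gain v q : (P <= decision v)%N -> (q < P)%N ->
  \sum_(u | center u == center v) gain (degree (level_graph q) u) <= 0.
Proof.
move=> dP qP; rewrite leNgt -center_gain; apply/negP => dq.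
have : has (fun q => dense_pack K W (\sum_(u | center u == center v) own q u)%N) (iota 0 P).
  by apply/hasP; exists q => //; rewrite mem_iota.
by rewrite has_find size_iota ltnNge dP.
Qed.

Lemma no_decision_not_dense q : (forall v, P <= decision v)%N -> (q < P)%N ->
  ~~ dense_level live K load (tm q) (lev q).
Proof.
move=> none qP; rewrite /dense_level -leNgt -subr_le0.
have := sum_gain (degree (level_graph q)) predT; rewrite /= => <-.
by apply: sum_by_center => // v; exact: no_decision_gain.
Qed.

Lemma decision_center u v : center u = center v -> decision u = decision v.
Proof. by rewrite /decision => ->. Qed.

(** A positive gain requires a vertex of degree above [K], and such a vertex would have been
    marked. *)
Lemma decision_of_not_marked v : next_marked = set0 -> (P <= decision v)%N.
Proof.
move=> n0; rewrite leqNgt; apply/negP => dP.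
have := decision_gain dP; rewrite ltNge => /negP; apply.
apply: sumr_le0 => u /eqP cu; rewrite /gain; case: ifP => [h|_]; last by rewrite oppr_le0.
have : u \in next_marked by rewrite !inE (@decision_center u v) // dP h orbT.
by rewrite n0 inE.
Qed.

(** The threshold graphs chosen by the clusters form a graph [E] of nonnegative gain, so by
    [edges_within_ge] the new vertices [U] are dense. Live edges avoid [marked], so old and new
    vertices are disjoint and their edge counts add. *)
Lemma next_marked_dense :
  2 * K * #|marked|%:R <= (edges_within (@edge G) marked)%:R ->
  2 * K * #|next_marked|%:R <= (edges_within (@edge G) next_marked)%:R.
Proof.
pose E v w := level_graph (decision v) v w && (decision v < P)%N.
have EsubL v w : E v w -> live v w by case/andP => /andP[].
have symE : symmetric E.
  move=> v w; rewrite /E /level_graph (level_sym (f := gives) live_sym) //.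
  rewrite /level; case lvw : (live w v) => //=.
  by rewrite (@decision_center v w) //; case/and4P: lvw => _ /eqP ->.
have degE v : degree E v = if (decision v < P)%N then degree (level_graph (decision v)) v else 0%N.
  rewrite /degree /E; case: (decision v < P)%N; last by rewrite big1 // => w _; rewrite andbF.
  by apply: eq_bigr => w _; rewrite andbT.
set U := next_marked :\: marked.
have UE : U = [set v | K < (degree E v)%:R].
  apply/setP => v; rewrite !inE degE.
  case: (ltnP (decision v) P) => dP /=; last first.
    by rewrite orbF andNb ltNge K_ge0.
  case: (boolP (v \in marked)) => [vm|] //=; apply/esym/negbTE.
  rewrite -leNgt /degree big1 // => w _.
  by rewrite /level_graph /level /live vm !andbF.
have gainE : 0 <= \sum_v gain (degree E v).
  rewrite -oppr_le0 -sumrN; apply: sum_by_center => // v.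
  rewrite sumrN oppr_le0; case: (ltnP (decision v) P) => dP.
    have := ltW (decision_gain dP); rewrite (eq_bigr (fun u => gain (degree E u))) //.
    by move=> u /eqP/decision_center e; rewrite degE e dP.
  rewrite big1 // => u /eqP/decision_center e.
  by rewrite degE e ltnNge dP /gain ltNge K_ge0 oppr0.
have Udense : 2 * K * #|U|%:R <= (edges_within E U)%:R.
  have UP v : (v \in U) = (K < (degree E v)%:R) by rewrite UE inE.
  have := edges_within_ge U symE; rewrite -(ler_nat R) natrD.
  rewrite sum_gain /= -UE in gainE; move: gainE.
  rewrite (eq_bigl (fun v => v \in U)) => [|v]; last by rewrite UP.
  rewrite [X in _ - X%:R - _](eq_bigl (fun v => v \in ~: U)) => [|v]; last by rewrite inE UP.
  lra.
move=> Mdense.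
have mU : next_marked = marked :|: U.
  by rewrite /U setDE setUIr setUCr setIT; apply/esym/setUidPr/subsetUl.
have dis : [disjoint marked & U].
  by rewrite -setI_eq0 /U setDE setICA setICr setI0.
rewrite mU cardsU (disjoint_setI0 dis) cards0 subn0 natrD mulrDr.
apply: le_trans (lerD Mdense Udense) _; rewrite -natrD ler_nat.
apply: edges_within_setU => //; by move=> v w /EsubL; case/and4P.
Qed.

End TrialAnalysis.

(** * Expected number of cut edges *)

Section TrialSuccess.
Variables (R : realType) (G : sgraph) (id : G -> nat) (B Rr : nat).
Variables (Om : finType) (rho : Om -> nat) (d1 d2 delta : R).
Hypothesis id_inj : injective id.
Hypothesis id_lt : forall v, (id v < B)%N.
Hypothesis rho_le : forall x, (rho x <= Rr)%N.
Hypothesis rho_tail : forall j,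
  #|[set x | (j <= rho x < j + 3)%N]|%:R <=
  d1 * #|[set x | (j <= rho x)%N]|%:R + d2 * #|Om|%:R.
Hypothesis delta_ge : d1 + #|G|%:R * d2 <= delta.

Definition crossing (E : rel G) (r : G -> nat) : rel G :=
  fun v w => E v w && (center id B Rr r v != center id B Rr r w).

Lemma crossing_no_gap (w : {ffun G -> Om}) (u v : G) : edge u v ->
  center id B Rr (fun x => rho (w x)) u != center id B Rr (fun x => rho (w x)) v ->
  ~~ has_gap rho Rr.+1 (dist Rr ^~ u) w.
Proof.
move=> uv; apply: contraNN => /existsP[x /forallP gap].
apply/eqP; apply: (@center_of_gap _ _ _ _ (fun x => rho (w x)) id_lt _ x) => // x' x'x.
exact: (implyP (gap x')).
Qed.

(** An edge is cut only if the scores at its first endpoint have no gap, which [card_no_gap] bounds;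
    the rest is linearity of expectation. *)
Lemma sum_crossing (E : rel G) (U : {set G}) : subrel E (@edge G) ->
  (\sum_(w : {ffun G -> Om})
     edges_within (crossing E (fun x => rho (w x))) U)%N%:R <=
  (edges_within E U)%:R * delta * #|{: {ffun G -> Om}}|%:R.
Proof.
move=> sE.
have bound v : (#|[set w : {ffun G -> Om} | ~~ has_gap rho Rr.+1 (dist Rr ^~ v) w]|%:R : R)
    <= delta * #|{: {ffun G -> Om}}|%:R.
  apply: le_trans (card_no_gap rho_tail Rr.+1 (dist Rr ^~ v) id_inj v) _.
  exact: ler_wpM2r.
rewrite /edges_within exchange_big /= natr_sum natr_sum -mulrA mulr_suml.
apply: ler_sum => v _; rewrite exchange_big /= !natr_sum mulr_suml.
apply: ler_sum => w _; rewrite /crossing; case Evw: (E v w); last first.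
  by rewrite mul0r big1.
rewrite mul1r; apply: le_trans (bound v).
rewrite ler_nat -sum1dep_card [leqRHS]big_mkcond /=; apply: leq_sum => x _.
case: (boolP (center _ _ _ _ v != _)) => //= cr.
by rewrite (crossing_no_gap (sE _ _ Evw) cr).
Qed.

Definition bad_shifts (E : rel G) (U : {set G}) : {set {ffun G -> Om}} :=
  [set w : {ffun G -> Om} | 2 * ((edges_within E U)%:R * delta) <
           (edges_within (crossing E (fun x => rho (w x))) U)%:R].

Lemma card_bad_shifts (E : rel G) (U : {set G}) : subrel E (@edge G) ->
  (0 < edges_within E U)%N -> 0 < delta ->
  (2 * #|bad_shifts E U| <= #|{: {ffun G -> Om}}|)%N.
Proof.
move=> sE e0 dl0; apply: markov_half; first by rewrite mulr_gt0 // ltr0n.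
exact: sum_crossing.
Qed.

End TrialSuccess.

(** * Sparsity of the uncut edges after an unsuccessful trial *)

Section TrialFinds.
Variables (R : realType) (K eta a : R) (B Rr T J W : nat).
Variables (G : sgraph) (id : G -> nat) (r : G -> nat).
Hypothesis id_lt : forall v, (id v < B)%N.
Hypothesis K_ge0 : 0 <= K.
Hypothesis W_large : (#|G| ^ 2 < W)%N.
Hypothesis eta_gt0 : 0 < eta.
Hypothesis eta_le : eta <= 4^-1.
Hypothesis T_gt0 : (0 < T)%N.
Hypothesis a_large : #|G|%:R ^+ 2 <= expR (eta * a).
Hypothesis J_large : #|G|%:R ^+ 2 * expR (- (eta * J%:R)) <= eta.
Hypothesis T_large : a <= eta * T%:R.

(** Item [t * J + j] stands for round [t] and threshold index [j]. *)
Definition item_time (q : nat) : nat := (q %/ J)%N.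
Definition item_level (q : nat) : R := level_floor eta a (q %/ J) + (q %% J)%:R.

(** With no marks, all uncut edges are live, so [sparse_of_no_dense] applies to the uncut part [E']
    of [E]. *)
Lemma sparse_of_no_find (E : rel G) (U : {set G}) :
  symmetric E -> subrel E (@edge G) ->
  next_marked K B Rr (T * J) W item_time item_level id r set0 = set0 ->
  (1 - 5 * eta) * ((edges_within E U)%:R -
     (edges_within (crossing id B Rr E r) U)%:R) <= 2 * K * #|U|%:R.
Proof.
move=> symE sE n0.
pose E' v w := E v w && (center id B Rr r v == center id B Rr r w).
have -> : (edges_within E U)%:R - (edges_within (crossing id B Rr E r) U)%:R =
   (edges_within E' U)%:R :> R.
  apply/eqP; rewrite subr_eq -natrD eqr_nat /edges_within -big_split /=; apply/eqP.
  apply: eq_bigr => v _; rewrite -big_split /=; apply: eq_bigr => w _.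
  by rewrite /E' /crossing; case: (E v w); case: (_ == _).
apply: (sparse_of_no_dense (lv := live B Rr id r set0) (T := T) (J := J) (a := a)
   (cov := load K B Rr id r set0) (f := give K B Rr id r set0)) => //.
- exact: live_sym.
- by move=> t v w; exact: share_bounds.
- by move=> t v; exact: give_cap.
- by move=> t v th; exact: give_greedy.
- move=> t j tT jJ; have J0 : (0 < J)%N by apply: leq_ltn_trans jJ.
  have qP : (t * J + j < T * J)%N.
    by apply: (@leq_trans (t * J + J)); rewrite ?ltn_add2l // -mulSnr leq_mul2r tT orbT.
  have := no_decision_not_dense (K := K) (tm := item_time) (lev := item_level) (r := r)
    (marked := set0) (W := W) (P := T * J) (Rr := Rr) W_large id_lt _ qP.
  rewrite /item_time /item_level divnMDl // divn_small // addn0.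
  rewrite modnMDl modn_small //; apply=> v.
  exact: (decision_of_not_marked W_large _ n0).
- by move=> v w; rewrite /E' symE eq_sym.
- by move=> v w /andP[/sE vw cc]; rewrite /live vw cc !inE.
Qed.

End TrialFinds.

(** * Round and message complexity *)

Lemma packed_total_le (n W : nat) : (1 < n)%N -> W = (n ^ 2).+1 ->
  (n * (W * W * n + W * n + 1) <= 8 * n ^ 6)%N.
Proof.
move=> n1 WE; pose m := (n ^ 2)%N.
have nm : (n <= m)%N by rewrite /m -mulnn leq_pmulr // ltnW.
have m0 : (0 < m)%N by apply: leq_trans nm; exact: ltnW.
have Wm : (W <= 2 * m)%N by rewrite WE -/m mul2n -addnn -addn1 leq_add2l.
have -> : (n * (W * W * n + W * n + 1) = W * W * m + W * m + n)%N.
  by rewrite !mulnDr muln1 ![(n * (_ * n))%N]mulnCA mulnn.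
have -> : (n ^ 6 = m * m * m)%N by rewrite /m -!expnD.
have := leq_mul (leq_mul Wm Wm) (leqnn m); have := leq_mul Wm (leqnn m).
have : (m * m <= m * m * m)%N by rewrite leq_pmulr.
have : (m <= m * m)%N by rewrite leq_pmulr.
move: m nm m0 Wm {WE n1}; lia.
Qed.

Section Tuning.
Variables (R : realType) (c k n : nat) (eps : R).

(** With [e] the floored accuracy, the covering loss [5 * eta] is [e / 4], while [3 * rate_of] and
    [n * slack_of] are [e / 16] each, so an edge is cut with probability at most [e / 8]. *)
Definition eta_of : R := eps_floor n eps / 20.
Definition offset_of : R := 2 * ln n%:R / eta_of.
Definition covers_of : nat := (Num.truncn (2 * ln n%:R / eta_of ^+ 2)).+1.
Definition levels_of : nat := (Num.truncn (11 * ln n%:R / eta_of)).+1.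
Definition rate_of : R := eps_floor n eps / 48.
Definition slack_of : R := eps_floor n eps / (16 * n%:R).
Definition radius_of : nat := (Num.truncn (9 * ln n%:R / rate_of)).+3.
Definition shift_bits_of : nat := (Num.truncn (2 / slack_of)).+1.
Definition trials_of : nat := (c * (trunc_log 2 n).+1)%N.
(** Makes [2 ^ word_of] exceed [n ^ (32 + k)]: the factor [n ^ k] is for IDs, the rest for counters
    polynomial in [n]. *)
Definition word_of : nat := ((32 + k) * (trunc_log 2 n).+1)%N.

Hypotheses (n_gt1 : (1 < n)%N) (eps01 : 0 < eps < 1).

Local Notation e' := (eps_floor n eps).
Local Notation l := (ln n%:R : R).

Let n0 : 0 < (n%:R : R). Proof. by rewrite ltr0n ltnW. Qed.
Let n2 : 2 <= (n%:R : R). Proof. by rewrite ler_nat. Qed.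
Let e0 : 0 < e'. Proof. by have [] := eps_floor_bounds n_gt1 eps01. Qed.
Let e1 : e' < 1. Proof. by have [] := eps_floor_bounds n_gt1 eps01. Qed.
Let e4 : n%:R ^- 4 <= e'. Proof. by have [] := eps_floor_bounds n_gt1 eps01. Qed.
Let eta0 : 0 < eta_of. Proof. by rewrite divr_gt0. Qed.

Let ln_half : 2^-1 <= l.
Proof.
rewrite -ler_expR lnK ?posrE //; apply: le_trans n2.
have := expR_ge1Dx (- 2^-1 : R); rewrite expRN => h.
have : 2^-1 <= (expR 2^-1)^-1 :> R by lra.
by rewrite lef_pV2 ?posrE ?expR_gt0.
Qed.

Let expl m : expR (m%:R * l) = n%:R ^+ m.
Proof. by rewrite expRM_natl lnK. Qed.

Lemma eta_of_gt0 : 0 < eta_of. Proof. exact: eta0. Qed.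
Lemma eta_of_le : eta_of <= 4^-1.
Proof. by rewrite /eta_of; have := e1; lra. Qed.

Lemma offset_large : n%:R ^+ 2 <= expR (eta_of * offset_of).
Proof.
by rewrite /offset_of mulrC divfK ?gt_eqF // expl.
Qed.

Let truncn_lt (x : R) : 0 <= x -> x <= (Num.truncn x).+1%:R.
Proof. by move=> x0; have /andP[_ /ltW] := truncn_itv x0. Qed.

Let l0 : 0 <= l. Proof. by apply: le_trans ln_half; rewrite invr_ge0. Qed.

Lemma covers_large : offset_of <= eta_of * covers_of%:R.
Proof.
rewrite mulrC -ler_pdivrMr // /offset_of.
have -> : 2 * l / eta_of / eta_of = 2 * l / eta_of ^+ 2.
  by rewrite -mulrA -invfM expr2.
by apply: truncn_lt; rewrite !mulr_ge0 ?invr_ge0 ?exprn_ge0 // ltW.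
Qed.

Let n16 : 16 <= (n%:R ^+ 4 : R).
Proof. by rewrite -natrX ler_nat -[16%N]/(2 ^ 4)%N leq_exp2r. Qed.

Let n32 : 32 <= (n%:R ^+ 5 : R).
Proof. by rewrite -natrX ler_nat -[32%N]/(2 ^ 5)%N leq_exp2r. Qed.

(** The left side is at most [n ^- 9], while the floor on the accuracy gives
    [eta_of >= n ^- 4 / 20], and [n ^ 5 >= 32]. *)
Lemma levels_large : n%:R ^+ 2 * expR (- (eta_of * levels_of%:R)) <= eta_of.
Proof.
have h : 11 * l <= eta_of * levels_of%:R.
  rewrite [leRHS]mulrC -ler_pdivrMr //; apply: truncn_lt.
  by rewrite !mulr_ge0 ?invr_ge0 // ltW.
apply: le_trans (_ : n%:R ^+ 2 * expR (- (11 * l)) <= _).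
  by rewrite ler_pM2l ?exprn_gt0 // ler_expR lerN2.
rewrite expRN expl ler_pdivrMr ?exprn_gt0 //.
rewrite (_ : n%:R ^+ 11 = n%:R ^+ 2 * (n%:R ^+ 5 * n%:R ^+ 4)); last by rewrite -!exprD.
rewrite mulrCA -[leLHS]mulr1 ler_pM2l ?exprn_gt0 // /eta_of.
have h4 : 1 <= e' * n%:R ^+ 4 by rewrite -ler_pdivrMr ?exprn_gt0 // mul1r.
rewrite mulrAC mulrC mulrA mulrC.
have : 1 * 32 <= (e' * n%:R ^+ 4) * n%:R ^+ 5 by rewrite ler_pM.
lra.
Qed.

Lemma rate_bounds : 0 < rate_of <= 3^-1.
Proof. by rewrite /rate_of; have := e0; have := e1; lra. Qed.

Lemma slack_gt0 : 0 < slack_of.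
Proof. by rewrite divr_gt0 // mulr_gt0. Qed.

(** The left side is at most [n ^- 9], the right side at least [n ^- 5 / 16], and [n ^ 4 >= 16]. *)
Lemma radius_large : (1 - rate_of) ^+ (radius_of - 2) <= slack_of.
Proof.
have /andP[r0 r3] := rate_bounds.
have h : 9 * l <= rate_of * (radius_of - 2)%:R.
  rewrite [leRHS]mulrC -ler_pdivrMr // /radius_of subSS subSS subn0; apply: truncn_lt.
  by rewrite !mulr_ge0 ?invr_ge0 // ltW.
apply: le_trans (_ : expR (- rate_of) ^+ (radius_of - 2) <= _).
  rewrite lerXn2r ?nnegrE ?expR_ge0 //; first by lra.
  exact: expR_ge1Dx.
rewrite -expRM_natl mulrN mulrC; apply: le_trans (_ : expR (- (9 * l)) <= _).
  by rewrite ler_expR lerN2.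
rewrite expRN expl -[leLHS]mul1r ler_pdivrMr ?exprn_gt0 // /slack_of.
rewrite mulrAC ler_pdivlMr ?mulr_gt0 // mul1r.
have h4 : 1 <= e' * n%:R ^+ 4 by rewrite -ler_pdivrMr ?exprn_gt0 // mul1r.
have h5 : 16 * n%:R <= n%:R ^+ 5 :> R by rewrite exprSr ler_pM2r.
have : 1 * (16 * n%:R) <= (e' * n%:R ^+ 4) * n%:R ^+ 5.
  by rewrite ler_pM // mulr_ge0 // ltW.
by rewrite mul1r -mulrA -exprD.
Qed.

Lemma shift_bits_large : 2 <= slack_of * 2 ^+ shift_bits_of.
Proof.
rewrite mulrC -ler_pdivrMr ?slack_gt0 //.
apply: le_trans (truncn_lt _) _; first by rewrite divr_ge0 ?(ltW slack_gt0).
by rewrite -natrX ler_nat ltnW // ltn_expl.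
Qed.

Lemma delta_small : 3 * rate_of + n%:R * slack_of = e' / 8.
Proof. rewrite /rate_of /slack_of; field; rewrite gt_eqF //. Qed.


Definition items_of : nat := (covers_of * levels_of)%N.
Definition rounds_of : nat :=
  (trials_of * (2 * radius_of.+1 + covers_of + (items_of + radius_of) + 2))%N.

Let trunc_le (x : R) : 0 <= x -> (Num.truncn x)%:R <= x.
Proof. by move=> x0; have /andP[] := truncn_itv x0. Qed.

Let le_div (x : R) m : 0 <= x -> x <= x / e' ^+ m.
Proof.
move=> x0; rewrite ler_pdivlMr ?exprn_gt0 // ler_piMr //.
by rewrite exprn_ile1 // ltW.
Qed.

Lemma covers_le : covers_of%:R <= 802 * (l / e' ^+ 2).
Proof.
rewrite /covers_of -natr1; apply: le_trans (_ : 800 * (l / e' ^+ 2) + 2 * l <= _).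
  apply: lerD; last by have := ln_half; lra.
  apply: le_trans (trunc_le _) _.
    by rewrite !mulr_ge0 ?invr_ge0 ?exprn_ge0 // ltW.
  by rewrite le_eqVlt; apply/orP; left; apply/eqP; rewrite /eta_of; field; rewrite gt_eqF.
have := le_div 2 l0; lra.
Qed.

Lemma levels_le : levels_of%:R <= 222 * (l / e').
Proof.
rewrite /levels_of -natr1; apply: le_trans (_ : 220 * (l / e') + 2 * l <= _).
  apply: lerD; last by have := ln_half; lra.
  apply: le_trans (trunc_le _) _.
    by rewrite !mulr_ge0 ?invr_ge0 // ltW.
  by rewrite le_eqVlt; apply/orP; left; apply/eqP; rewrite /eta_of; field; rewrite gt_eqF.
have := le_div 1 l0; rewrite expr1; lra.
Qed.

Lemma radius_le : radius_of%:R <= 438 * (l / e').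
Proof.
rewrite /radius_of -addn3 natrD.
apply: le_trans (_ : 432 * (l / e') + 6 * l <= _).
  apply: lerD; last by have := ln_half; lra.
  apply: le_trans (trunc_le _) _.
    by rewrite !mulr_ge0 ?invr_ge0 //; have /andP[/ltW] := rate_bounds.
  by rewrite le_eqVlt; apply/orP; left; apply/eqP; rewrite /rate_of; field; rewrite gt_eqF.
have := le_div 1 l0; rewrite expr1; lra.
Qed.

Lemma items_le : items_of%:R <= (802 * 222) * (l ^+ 2 / e' ^+ 3).
Proof.
rewrite /items_of natrM; apply: le_trans (ler_pM _ _ covers_le levels_le) _ => //.
by rewrite le_eqVlt; apply/orP; left; apply/eqP; field; rewrite gt_eqF.
Qed.

Lemma log_le : (trunc_log 2 n).+1%:R <= 4 * l.
Proof.
rewrite -natr1.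
have h : 2^-1 * (trunc_log 2 n)%:R <= l.
  have : 2 ^+ trunc_log 2 n <= (n%:R : R).
    by rewrite -natrX ler_nat trunc_logP // ltnW.
  rewrite -ler_ln ?posrE ?exprn_gt0 // lnXn // -[_ *+ _]mulr_natr.
  apply: le_trans; rewrite ler_wpM2r //.
  rewrite -ler_expR lnK ?posrE //.
  have := expR_ge1Dx (- 2^-1 : R); rewrite expRN => h.
  have : 2^-1 <= (expR 2^-1)^-1 :> R by lra.
  by rewrite lef_pV2 ?posrE ?expR_gt0.
have := ln_half; lra.
Qed.

(** The items dominate a trial, with order [l ^+ 2 / e' ^+ 3]. The number of trials adds a
    logarithm, and [eps <= e'] removes the floor. *)
Lemma rounds_le :
  rounds_of%:R <= (4 * (1000 * 200) * c%:R) * (l ^+ 3 / eps ^+ 3).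
Proof.
have /andP[eps0 eps1] := eps01.
set u := l ^+ 2 / e' ^+ 3.
have l1 : l <= 2 * l ^+ 2.
  have := ler_wpM2l l0 ln_half; rewrite -expr2; lra.
have y_u : l / e' <= 2 * u.
  rewrite /u mulrA; apply: le_trans (_ : 2 * l ^+ 2 / e' <= _).
    by rewrite ler_pM2r ?invr_gt0.
  rewrite ler_pM2l; last by rewrite mulr_gt0 // exprn_gt0 //; have := ln_half; lra.
  by rewrite lef_pV2 ?posrE ?exprn_gt0 // exprS ler_piMr // ?ltW // exprn_ilt1 // ltW.
have x_u : l / e' ^+ 2 <= 2 * u.
  rewrite /u mulrA; apply: le_trans (_ : 2 * l ^+ 2 / e' ^+ 2 <= _).
    by rewrite ler_pM2r ?invr_gt0 ?exprn_gt0.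
  rewrite ler_pM2l; last by rewrite mulr_gt0 // exprn_gt0 //; have := ln_half; lra.
  by rewrite lef_pV2 ?posrE ?exprn_gt0 // exprSr ler_piMr ?exprn_ge0 // ltW.
have u1 : 1 <= 4 * u.
  apply: le_trans (_ : 4 * l ^+ 2 <= _).
    have := ler_pM _ _ ln_half ln_half; rewrite -expr2 invr_ge0 => /(_ (ler0n _ _) (ler0n _ _)).
    lra.
  by rewrite ler_pM2l // le_div // exprn_ge0.
rewrite /rounds_of /trials_of.
have per : (2 * radius_of.+1 + covers_of + (items_of + radius_of) + 2)%N%:R <= (1000 * 200) * u.
  rewrite !natrD natrM -(natr1 radius_of).
  have := covers_le; have := items_le; have := radius_le; rewrite -/u; lra.
rewrite !natrM.
apply: le_trans (_ : (c%:R * (4 * l)) * ((1000 * 200) * u) <= _).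
  by rewrite ler_pM // ?mulr_ge0 // ler_wpM2l // log_le.
rewrite [leLHS](_ : _ = 4 * (1000 * 200) * c%:R * (l ^+ 3 / e' ^+ 3)); last first.
  by rewrite /u; field; rewrite gt_eqF.
apply: ler_wpM2l; first by rewrite !mulr_ge0.
rewrite ler_wpM2l ?exprn_ge0 // lef_pV2 ?posrE ?exprn_gt0 //.
have [_ _ ee _] := eps_floor_bounds n_gt1 eps01.
by rewrite lerXn2r ?nnegrE // ltW.
Qed.

Lemma word_le : word_of%:R <= (4 * (32 + k)%:R) * l.
Proof.
rewrite /word_of natrM mulrAC [leRHS]mulrC ler_wpM2l //.
exact: log_le.
Qed.

Lemma word_large : (n ^ (32 + k) < 2 ^ word_of)%N.
Proof. by rewrite /word_of mulnC expnM ltn_exp2r // trunc_log_ltn. Qed.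

Let pow2_le m : (2 ^ m <= n ^ m)%N.
Proof. by case: m => // m; rewrite leq_exp2r. Qed.

Let word_of_nat m : (m <= n ^ (32 + k))%N -> (m < 2 ^ word_of)%N.
Proof. by move=> h; apply: leq_ltn_trans word_large. Qed.

Let npow i j : (i <= j)%N -> (n ^ i <= n ^ j)%N.
Proof. by move=> ij; rewrite leq_exp2l. Qed.

Let l_le : l <= n%:R.
Proof.
have := expR_ge1Dx l; rewrite lnK ?posrE //; lra.
Qed.

Let inv_e : e'^-1 <= n%:R ^+ 4.
Proof. by rewrite -[leRHS]invrK lef_pV2 ?posrE ?invr_gt0 ?exprn_gt0. Qed.

Lemma word_card : (n < 2 ^ word_of)%N.
Proof. by apply: word_of_nat; rewrite -{1}(expn1 n) npow. Qed.

Lemma word_claim : ((radius_of.+1 * n ^ k).*2 < 2 ^ word_of)%N.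
Proof.
apply: word_of_nat; rewrite expnD.
apply: (@leq_trans ((radius_of.+1).*2 * n ^ k)); first by rewrite -!muln2 mulnAC.
rewrite leq_mul2r; apply/orP; right.
apply: (@leq_trans (n ^ 10 * n ^ 5)); last by rewrite -expnD npow.
rewrite -(ler_nat R) natrM !natrX -muln2 natrM -natr1.
have h : radius_of%:R <= 438 * n%:R ^+ 5 :> R.
  apply: le_trans radius_le _; rewrite ler_pM2l // exprS ler_pM ?invr_ge0 // ltW //.
have p10 : 1024 <= n%:R ^+ 10 :> R.
  by rewrite -natrX ler_nat -[1024%N]/(2 ^ 10)%N pow2_le.
have p5 : 1 <= n%:R ^+ 5 :> R by rewrite exprn_ege1 // ler1n ltnW.
have := ler_wpM2r (le_trans ler01 p5) p10; lra.
Qed.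

Lemma word_items : (items_of < 2 ^ word_of)%N.
Proof.
apply: word_of_nat; apply: (@leq_trans (n ^ 18 * n ^ 14)); last first.
  by rewrite -expnD npow // leq_addr.
rewrite -(ler_nat R) natrM !natrX; apply: le_trans items_le _.
have p18 : 802 * 222 <= n%:R ^+ 18 :> R.
  rewrite -[18%N]/(10 + 8)%N exprD -!natrX; apply: ler_pM => //; rewrite ler_nat.
    exact: leq_trans (pow2_le 10).
  exact: leq_trans (pow2_le 8).
apply: (ler_pM _ _ p18); first by rewrite mulr_ge0.
  by rewrite divr_ge0 ?exprn_ge0 // ltW.
rewrite (_ : n%:R ^+ 14 = n%:R ^+ 2 * (n%:R ^+ 4) ^+ 3); last by rewrite -exprM -exprD.
rewrite -exprVn ler_pM ?exprn_ge0 ?invr_ge0 ?(ltW e0) //.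
  by rewrite lerXn2r ?nnegrE.
by rewrite lerXn2r ?nnegrE ?exprn_ge0 ?invr_ge0 ?(ltW e0).
Qed.

Lemma word_total (W : nat) : W = (n ^ 2).+1 ->
  (n * (W * W * n + W * n + 1) < 2 ^ word_of)%N.
Proof.
move=> WE; apply: word_of_nat.
apply: (@leq_trans (n ^ 3 * n ^ 6)); last by rewrite -expnD npow.
have p3 : (8 <= n ^ 3)%N by exact: (pow2_le 3).
apply: leq_trans (leq_mul p3 (leqnn _)).
exact: packed_total_le.
Qed.

End Tuning.

(** * Correctness of the algorithm *)

Section Unpack.
Variables (L b : nat).

Lemma card_unpack :
  #|{: (L * b).-tuple bool}| = #|{: {ffun 'I_L -> b.-tuple bool}}|.
Proof. by rewrite card_ffun !card_tuple card_ord -expnM mulnC. Qed.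

(** An arbitrary bijection between sets of equal size: this is enough for the [L] blocks to be
    uniform and independent. *)
Definition unpack (x : (L * b).-tuple bool) : {ffun 'I_L -> b.-tuple bool} :=
  enum_val (cast_ord card_unpack (enum_rank x)).

Lemma unpack_inj : injective unpack.
Proof. by move=> x y /enum_val_inj/cast_ord_inj/enum_rank_inj. Qed.

End Unpack.

Section Algorithm.
Variables (R : realType) (c k n : nat) (Dt eps : R).

Let L := trials_of c n.
Let b := shift_bits_of n eps.
Let eta : R := eta_of n eps.
Let off : R := offset_of n eps.
Let K := capacity n Dt eps.
Let Rr := radius_of n eps.
Let T := covers_of n eps.
Let J := levels_of n eps.
Let P := items_of n eps.
Let W := (n ^ 2).+1.
Let B := (n ^ k)%N.

Definition vertex_shift (x : (L * b).-tuple bool) (i : nat) : nat :=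
  if insub i is Some j then shift (rate_of n eps) Rr (unpack x j) else 0%N.

Definition init_state (i : nat) (nb : seq nat) (x : (L * b).-tuple bool) : lstate R :=
  LState i nb (vertex_shift x) false 0 (fun=> 0%N) (fun _ _ => 0) (fun=> 0%N) 0.

Definition schedule : seq (step (lstate R)) :=
  flatten [seq trial K B Rr T P W (item_time J) (item_level eta off J) i | i <- iota 0 L].

Definition dense_program : congest_program :=
  protocol (word_of k n) schedule init_state (@lmark R).

(** For one vertex, [ln n = 0] allows neither rounds nor message bits, and the required probability
    is 0. For [Dt = 0] the whole graph is a valid output. *)
Definition constant_program : congest_program :=
  protocol 0 [::] (fun _ _ (_ : 0.-tuple bool) => tt) (fun=> Dt == 0).

Definition algorithm : congest_program :=
  if (1 < n)%N && (0 < Dt) then dense_program else constant_program.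

Lemma size_schedule : size schedule = rounds_of c n eps.
Proof.
rewrite /schedule size_flatten /shape -map_comp /rounds_of.
rewrite (eq_map (g := fun=> (2 * Rr.+1 + T + (P + Rr) + 2)%N)); last first.
  by move=> i; exact: size_trial.
rewrite sumnE big_map big_const_seq count_predT size_iota iter_addn_0 mulnC.
by [].
Qed.

Variables (G : sgraph) (id : G -> nat).
Hypotheses (Gn : #|G| = n) (n_gt1 : (1 < n)%N) (Dt_gt0 : 0 < Dt).
Hypotheses (eps01 : 0 < eps < 1) (id_inj : injective id).
Hypothesis id_lt : forall v, (id v < B)%N.

Let W_large : (#|G| ^ 2 < W)%N. Proof. by rewrite Gn. Qed.
Let K_ge0 : 0 <= K. Proof. exact: capacity_ge0. Qed.

Section Run.
Variable w : coins G dense_program.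

Definition tape (v : G) (i : nat) : nat := vertex_shift (w v) i.

Definition mark_after (m : nat) : {set G} :=
  iteri m (fun i S => next_marked K B Rr P W (item_time J) (item_level eta off J)
                        id (tape ^~ i) S) set0.

Lemma tape_le v i : (tape v i <= Rr)%N.
Proof. by rewrite /tape /vertex_shift; case: insubP => // *; exact: shift_le. Qed.

Lemma hoare_schedule :
  hoare id (word_of k n) (fixed_part P id tape set0) schedule
    (fixed_part P id tape (mark_after L)).
Proof.
pose F i := trial K B Rr T P W (item_time J) (item_level eta off J) i.
rewrite /schedule -/F; elim: L => [X|m IH]; first by split.
rewrite -addn1 iotaD map_cat flatten_cat add0n.
have -> : flatten [seq F i | i <- iota m 1] = F m by exact: cats0.
apply: hoare_cat IH _; rewrite addn1 [mark_after m.+1]/mark_after iteriS -/(mark_after m).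
apply: hoare_trial => //.
- by move=> v; exact: tape_le.
- move=> q; rewrite /P /items_of => qP; rewrite /item_time.
  by rewrite -ltnS ltn_divLR // (leq_trans qP) // leq_mul2r leqnSn orbT.
- by apply: word_claim.
- by rewrite Gn; apply: word_card.
- by apply: word_items.
- by rewrite Gn; exact: word_total.
Qed.

Lemma result_mark v : result id w v = (v \in mark_after L).
Proof.
have I0 : fixed_part P id tape set0
    (fun u => init_state (id u) (neighbour_ids id u) (w u)).
  by move=> u; split=> //=; rewrite inE.
have [f q] := hoare_schedule I0.
by rewrite protocol_run //; have [_ _ _ ->] := q v.
Qed.

Lemma mark_dense m :
  2 * K * #|mark_after m|%:R <= (edges_within (@edge G) (mark_after m))%:R.
Proof.
elim: m => [|m IH] /=; first by rewrite cards0 mulr0.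
exact: next_marked_dense.
Qed.

Lemma mark_mono m : mark_after m.+1 = set0 -> mark_after m = set0.
Proof. by rewrite /mark_after /= => /eqP; rewrite setU_eq0 => /andP[/eqP]. Qed.

Lemma mark_after_set0 m i : mark_after m = set0 -> (i <= m)%N -> mark_after i = set0.
Proof.
move=> h im; move: h; rewrite -(subnK im); elim: (m - i)%N => // d IH h.
by apply: IH; exact: mark_mono.
Qed.

Lemma mark_sound : mark_after L != set0 ->
  (1 - eps) * Dt <= density R (induced (mark_after L)).
Proof.
rewrite -card_gt0 => S0; rewrite /density /=.
have := mark_dense L; rewrite card_induced natrM -mulrA ler_pM2l // => h.
apply: (capacity_sound n_gt1 Dt_gt0 eps01) h.
- by rewrite S0 -Gn max_card.
- rewrite -Gn -(leq_pmul2l (isT : 0 < 2)%N) -card_induced.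
  by apply: leq_trans (edges_within_le_sqr _ _) _; rewrite leq_pmull.
Qed.

End Run.

Definition trial_coins (w : coins G dense_program) : {ffun 'I_L -> {ffun G -> b.-tuple bool}} :=
  [ffun j => [ffun v => unpack (w v) j]].

Lemma trial_coins_inj : injective trial_coins.
Proof.
move=> w w' e; apply/ffunP => v; apply: unpack_inj; apply/ffunP => j.
by have /ffunP/(_ v) := congr1 (fun f : {ffun _ -> _} => f j) e; rewrite !ffunE.
Qed.

Lemma card_trial_coins :
  #|{: {ffun 'I_L -> {ffun G -> b.-tuple bool}}}| = #|coins G dense_program|.
Proof.
rewrite /coins !card_ffun !card_tuple card_ord -!expnM; congr expn.
by rewrite mulnCA mulnC [(b * L)%N]mulnC.
Qed.

Let delta : R := eps_floor n eps / 8.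

(** At most a fraction [e / 4] of the edges is cut, and covering loses another factor [1 - e / 4].
    With [capacity_complete], an unsuccessful trial would give [(1 - e / 4) ^+ 2 <= 1 - e], which is
    false. *)
Lemma trial_finds (E : rel G) (U : {set G}) (w : {ffun G -> b.-tuple bool}) :
  symmetric E -> subrel E (@edge G) -> (0 < #|U|)%N ->
  (0 < edges_within E U)%N ->
  (exists2 m, edges_within E U = 2 * m & m <= #|G| ^ 2)%N ->
  2 * Dt * #|U|%:R <= (edges_within E U)%:R ->
  w \notin bad_shifts id B Rr (@shift R (rate_of n eps) Rr b) delta E U ->
  next_marked K B Rr P W (item_time J) (item_level eta off J) id
     (fun v => shift (rate_of n eps) Rr (w v)) set0 != set0.
Proof.
move=> symE sE U0 e0 [m em mn] dens nbad; apply/negP => /eqP n0.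
have [f0 f1 _ _] := eps_floor_bounds n_gt1 eps01.
have := sparse_of_no_find (K := K) (eta := eta) (a := off) (T := T) (J := J) (W := W)
  id_lt K_ge0 W_large (eta_of_gt0 n_gt1 eps01) (eta_of_le n_gt1 eps01) _ _ _
  (covers_large n_gt1 eps01) U symE sE n0.
rewrite Gn => /(_ isT (offset_large n_gt1 eps01) (levels_large n_gt1 eps01)).
move: nbad; rewrite inE -leNgt => few sparse.
have K_le : K * #|U|%:R <= (1 - eps_floor n eps) * m%:R.
  apply: (capacity_complete n_gt1 Dt_gt0 eps01).
  - by rewrite U0 -Gn max_card.
  - by rewrite -Gn.
  - by move: dens; rewrite em natrM -mulrA ler_pM2l.
have m0 : 0 < (m%:R : R) by rewrite ltr0n; move: e0; rewrite em; case: (m).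
move: few sparse; rewrite em natrM; set X := (edges_within _ _)%:R.
rewrite /eta /eta_of /delta => few sparse.
set e := eps_floor n eps in f0 f1 K_le few sparse.
have h1 : (1 - e / 4) * (1 - e / 4) * (2 * m%:R) <= (1 - 5 * (e / 20)) * (2 * m%:R - X).
  rewrite -mulrA (_ : 5 * (e / 20) = e / 4); last by field.
  apply: ler_wpM2l; first lra.
  by lra.
have h2 : (1 - e / 4) * (1 - e / 4) * (2 * m%:R) <= (1 - e) * (2 * m%:R).
  by apply: le_trans h1 (le_trans sparse _); rewrite -mulrA; lra.
move: h2; rewrite ler_pM2r ?mulr_gt0 //.
have : 0 < e * e by rewrite mulr_gt0.
lra.
Qed.

(** Marks are never removed, so an empty final set means that every trial started without marks and
    found nothing. *)
Lemma failure_trials (E : rel G) (U : {set G}) (w : coins G dense_program) :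
  symmetric E -> subrel E (@edge G) -> (0 < #|U|)%N ->
  (0 < edges_within E U)%N ->
  (exists2 m, edges_within E U = 2 * m & m <= #|G| ^ 2)%N ->
  2 * Dt * #|U|%:R <= (edges_within E U)%:R ->
  mark_after w L = set0 ->
  [forall j, trial_coins w j \in bad_shifts id B Rr (@shift R (rate_of n eps) Rr b) delta E U].
Proof.
move=> symE sE U0 e0 em dens none; apply/forallP => j; apply/negPn/negP => good.
have := trial_finds symE sE U0 e0 em dens good.
have -> : (fun v => shift (rate_of n eps) Rr (trial_coins w j v)) = tape w ^~ j.
  apply: boolp.funext => v; rewrite /tape /vertex_shift insubT //= => jL.
  by rewrite /trial_coins !ffunE; congr (shift _ _ (unpack _ _)); exact: val_inj.
have := mark_after_set0 none (ltn_ord j).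
rewrite [mark_after w j.+1]/mark_after iteriS -/(mark_after w j).
by rewrite (mark_after_set0 none (ltnW (ltn_ord j))) => ->; rewrite eqxx.
Qed.

(** A nonempty output is always dense enough, so failure means an empty output with [Dt] at most the
    maximum density. Then all [L] trials have bad shifts, each for at most half of its coins, and
    [2 ^ L >= n ^ c]. *)
Lemma dense_program_correct :
  1 - 1 / n%:R ^+ c <=
  prob R (fun w : coins G dense_program => dense_subgraph Dt eps (result id w)).
Proof.
have n0 : 0 < (n%:R ^+ c : R) by rewrite exprn_gt0 // ltr0n ltnW.
set ok := fun w => _.
have resE w : [set u | result id w u] = mark_after w L.
  by apply/setP => v; rewrite inE result_mark.
have soundE w : ~~ ok w -> Dt <= max_density R G /\ mark_after w L = set0.
  rewrite /ok /dense_subgraph /= resE.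
  case: (eqVneq (mark_after w L) set0) => [->|ne] /=.
    by rewrite implybF negbK.
  by rewrite mark_sound // implybT.
have M0 : (0 < #|coins G dense_program|)%N.
  by apply/card_gt0P; exists [ffun=> [tuple of nseq _ false]].
have key : (n ^ c * #|[set w | ~~ ok w]| <= #|coins G dense_program|)%N.
  case: (leP Dt (max_density R G)) => [dle|dgt]; last first.
    rewrite (_ : #|_| = 0%N) ?muln0 //; apply: eq_card0 => w; rewrite !inE.
    by apply/negbTE/negP => /soundE[]; rewrite leNgt dgt.
  have [U [E [symE sE U0 [dens em]]]] := max_density_witness Dt_gt0 dle.
  have e0 : (0 < edges_within E U)%N.
    rewrite -(ltr_nat R); apply: lt_le_trans dens.
    by rewrite !mulr_gt0 // ltr0n.
  pose Bad := bad_shifts id B Rr (@shift R (rate_of n eps) Rr b) delta E U.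
  have half : (2 * #|Bad| <= #|{: {ffun G -> b.-tuple bool}}|)%N.
    apply: card_bad_shifts => //.
    - by move=> x; exact: shift_le.
    - apply: shift_tail.
      + exact: rate_bounds.
      + exact: shift_bits_large.
      + exact: radius_large.
    - by rewrite Gn delta_small.
    - by rewrite divr_gt0 //; have [] := eps_floor_bounds n_gt1 eps01.
  rewrite -card_trial_coins; apply: leq_trans (card_all_bad L half).
  apply: leq_mul.
    rewrite /L /trials_of mulnC expnM; case: (c) => // c'.
    by rewrite leq_exp2r // ltnW // trunc_log_ltn.
  rewrite -(card_imset _ trial_coins_inj) subset_leq_card //.
  apply/subsetP => f /imsetP[w]; rewrite inE => /soundE[_ none] ->.
  by rewrite inE; exact: failure_trials.
have M0r : 0 < (#|coins G dense_program|%:R : R) by rewrite ltr0n.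
have split_ok : (#|[set w | ok w]| + #|[set w | ~~ ok w]| = #|coins G dense_program|)%N.
  rewrite -(cardsC [set w | ok w]); congr addn; apply: eq_card => w.
  by rewrite !inE.
rewrite /prob -/ok ler_pdivlMr // mulrBl mul1r.
move/(congr1 (fun m : nat => m%:R : R)): split_ok; rewrite natrD => split_ok.
have : #|[set w | ~~ ok w]|%:R <= 1 / n%:R ^+ c * #|coins G dense_program|%:R :> R.
  by rewrite mulrAC mul1r ler_pdivlMr // -natrX -natrM ler_nat mulnC.
lra.
Qed.

End Algorithm.

Theorem theorem2 (R : realType) (c k : nat) :
  exists (Cr Cb : R) (A : nat -> R -> R -> congest_program),
  forall (G : sgraph) (id : G -> nat) (Dt eps : R),
    (0 < #|G|)%N -> id_assignment k id -> 0 <= Dt -> 0 < eps < 1 ->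
    let n := #|G| in
    let P := A n Dt eps in
    [/\ (rounds P)%:R <= Cr * (ln n%:R ^+ 3 / eps ^+ 3),
        (bandwidth P)%:R <= Cb * ln n%:R &
        1 - 1 / n%:R ^+ c <=
          prob R (fun w : coins G P => dense_subgraph Dt eps (result id w))].
Proof.
exists (4 * (1000 * 200) * c%:R), (4 * (32 + k)%:R), (algorithm c k).
move=> G id Dt eps G0 [id_inj id_lt] Dt0 eps01 n P.
have /andP[eps0 eps1] := eps01.
rewrite /P /algorithm; case: ifP => [/andP[n1 Dt_gt0]|triv].
  split; first by rewrite /= size_schedule; exact: rounds_le.
    by apply: word_le.
  exact: dense_program_correct.
have l0 : 0 <= ln (n%:R : R) by rewrite ln_ge0 // ler1n.
split; rewrite /=.
- by rewrite !mulr_ge0 ?exprn_ge0 // invr_ge0 exprn_ge0 // ltW.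
- by rewrite !mulr_ge0.
set ok := fun w => _.
have M0 : (0 < #|coins G (constant_program Dt)|)%N.
  by apply/card_gt0P; exists [ffun=> [tuple]].
case: (ltnP 1 n) => n1 in triv; last first.
  have -> : n = 1%N by apply/eqP; rewrite eqn_leq n1.
  by rewrite expr1n divr1 subrr /prob divr_ge0.
have Dt_eq0 : Dt = 0 by apply/eqP; rewrite eq_le Dt0 andbT leNgt; move: triv => /= ->.
have ok1 w : ok w.
  rewrite /ok /dense_subgraph Dt_eq0 mulr0 /result /= eqxx.
  rewrite divr_ge0 // implybT /=; apply/implyP => _.
  by have /card_gt0P[v _] := G0; apply/set0Pn; exists v; rewrite inE.
rewrite /prob (_ : #|[set w | ok w]| = #|coins G (constant_program Dt)|).
  rewrite divff ?gt_eqF ?ltr0n // gerBl divr_ge0 // exprn_ge0 //.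
by apply: eq_card => w; rewrite inE ok1.
Qed.
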